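(* Let $(R,\Gamma)$ be a Hopf algebroid over a commutative Noetherian local ring $(R,\mathfrak{m})$ with residue field $\Bbbk=R/\mathfrak{m}$. Suppose that $\mathfrak{m}$ is invariant, i.e. $\mathfrak{m}\Gamma=\Gamma\mathfrak{m}$, and that $(\Bbbk,\Gamma/\mathfrak{m}\Gamma)$ is a unipotent Hopf algebroid over $\Bbbk$. Let $M$ be a non-trivial finitely generated discrete $(R,\Gamma)$-comodule. Then $M$ admits a finite-length filtration by subcomodules \[ M=M_\ell\supset M_{\ell-1}\supset\cdots\supset M_1\supset M_0=\{0\} \] with trivial quotient comodules $M_k/M_{k-1}\cong\Bbbk$ for $1\leq k\leq \ell$.
   Context: A Hopf algebroid $(R,\Gamma)$ is a cogroupoid object in commutative rings (algebras over a ground ring), with left and right units $\eta_L,\eta_R\colon R\to\Gamma$, counit $\epsilon\colon\Gamma\to R$, coproduct $\psi\colon\Gamma\to\Gamma\otimes_R\Gamma$ (bimodule tensor product) and antipode $\chi$. $\mathfrak{m}\Gamma$ denotes the ideal of $\Gamma$ generated by $\eta_L(\mathfrak{m})$ and $\Gamma\mathfrak{m}$ the ideal generated by $\eta_R(\mathfrak{m})$. If $\mathfrak{m}$ is invariant, $(\Bbbk,\Gamma/\mathfrak{m}\Gamma)$ inherits the structure of a Hopf algebroid. Comodules are left comodules, with coaction $\rho\colon M\to\Gamma\otimes_R M$ which is $R$-linear, coassociative and counital. An element $x$ is primitive if $\rho(x)=1\otimes x$. The comodule $\Bbbk$ has the trivial coaction, with $1$ primitive. A comodule $M$ is finitely generated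 if it is finitely generated as an $R$-module. It is discrete if for each $x\in M$ there is $k\geq1$ with $\mathfrak{m}^kx=\{0\}$ (for finitely generated $M$: $\mathfrak{m}^{k_0}M=\{0\}$ for some $k_0$). A Hopf algebroid $(\boldsymbol{k},\Sigma)$ over a field $\boldsymbol{k}$ is unipotent if every non-trivial finite dimensional $\Sigma$-comodule $V$ has non-trivial primitives.
   Formalization: The formal theorem additionally assumes that Γ is flat over R (via the right unit), the usual standing convention for comodules; without flatness the statement as printed is false. *)

(* Defs.v *)
From HB Require Import structures.
From mathcomp Require Import all_boot all_algebra.
From mathcomp Require Import generic_quotient ring_quotient.
From mathcomp Require Import boolp classical_sets.

Set Implicit Arguments.
Unset Strict Implicit.
Unset Printing Implicit Defensive.

Import GRing.Theory.
Local Open Scope ring_scope.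
Local Open Scope quotient_scope.
Local Open Scope classical_set_scope.

Section Tensor.
Variables (R : comNzRingType) (M N : lmodType R).

(* A list stands for the sum of the pure tensors of its entries.  Negatives
   need no constructor of their own: (- x) (x) y is one.                      *)
Inductive tens_rel : seq (M * N) -> seq (M * N) -> Prop :=
| tens_refl s : tens_rel s s
| tens_sym s t : tens_rel s t -> tens_rel t s
| tens_trans s t u : tens_rel s t -> tens_rel t u -> tens_rel s u
| tens_cat s s' t t' :
    tens_rel s s' -> tens_rel t t' -> tens_rel (s ++ t) (s' ++ t')
| tens_comm s t : tens_rel (s ++ t) (t ++ s)
| tens_zero : tens_rel [:: (0, 0)] [::]
| tens_addl x x' y : tens_rel [:: (x + x', y)] [:: (x, y); (x', y)]
| tens_addr x y y' : tens_rel [:: (x, y + y')] [:: (x, y); (x, y')]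
| tens_scale a x y : tens_rel [:: (a *: x, y)] [:: (x, a *: y)].

Definition tens_eqv s t : bool := `[< tens_rel s t >].

Lemma tens_eqv_equiv : equiv_class_of tens_eqv.
Proof.
split=> [s|s t|t s u].
- by apply/asboolP; apply: tens_refl.
- by apply/asboolP/asboolP; apply: tens_sym.
- by move=> /asboolP h1 /asboolP h2; apply/asboolP; apply: tens_trans h1 h2.
Qed.

Canonical tens_equiv := EquivRelPack tens_eqv_equiv.
Canonical tens_encModRel := defaultEncModRel tens_eqv.

Definition tens := {eq_quot tens_eqv}.
HB.instance Definition _ := Choice.on tens.
HB.instance Definition _ := EqQuotient.on tens.

Implicit Types (s : seq (M * N)) (t u : tens).

Lemma tens_piP s s' : tens_rel s s' <-> \pi_tens s = \pi_tens s'.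
Proof.
split=> h; first by apply/eqP; rewrite piE; apply/asboolP.
by apply/asboolP; move/eqP: h; rewrite piE.
Qed.

Let neg s := [seq (- p.1, p.2) | p <- s].
Definition tens_add t u : tens := \pi_tens (repr t ++ repr u).
Definition tens_opp t : tens := \pi_tens (neg (repr t)).

Let reprP s : tens_rel (repr (\pi_tens s)) s.
Proof. by apply/tens_piP; rewrite reprK. Qed.

Let pi_cat s s' : \pi_tens (s ++ s') = tens_add (\pi_tens s) (\pi_tens s').
Proof. by apply/tens_piP; apply: tens_sym; apply: tens_cat; apply: reprP. Qed.

Let tens0l y : tens_rel [:: (0, y)] [::].
Proof.
rewrite -[X in (X, y)](scale0r (0 : M)).
apply: tens_trans (tens_scale _ _ _) _; rewrite scale0r; exact: tens_zero.
Qed.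

Let neg_cancel s : tens_rel (neg s ++ s) [::].
Proof.
elim: s => [|[x y] s IH] /=; first exact: tens_refl.
have step : tens_rel ([:: (- x, y)] ++ ((neg s ++ [:: (x, y)]) ++ s))
                     ([:: (- x, y)] ++ (([:: (x, y)] ++ neg s) ++ s)).
  apply: tens_cat; first exact: tens_refl.
  by apply: tens_cat; [exact: tens_comm|exact: tens_refl].
rewrite -catA /= in step; apply: tens_trans step _.
apply: (@tens_cat [:: (- x, y); (x, y)] [::] (neg s ++ s) [::]) => //.
apply: tens_trans (tens_sym (tens_addl _ _ _)) _; rewrite addNr; exact: tens0l.
Qed.

Let add_assoc : associative tens_add.
Proof.
move=> t u v; apply/tens_piP.
apply: (@tens_trans _ (repr t ++ (repr u ++ repr v))).
  by apply: tens_cat; [exact: tens_refl|exact: reprP].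
rewrite catA; apply: tens_cat; last exact: tens_refl.
by apply: tens_sym; exact: reprP.
Qed.
Let add_comm : commutative tens_add.
Proof. by move=> t u; apply/tens_piP/tens_comm. Qed.
Let add_0 : left_id (\pi_tens [::]) tens_add.
Proof.
move=> t; rewrite -[RHS]reprK; apply/tens_piP.
apply: (@tens_cat _ [::] (repr t) (repr t)); first exact: reprP.
exact: tens_refl.
Qed.
Let add_opp : left_inverse (\pi_tens [::]) tens_opp tens_add.
Proof.
move=> t; apply/tens_piP; apply: tens_trans (neg_cancel (repr t)).
by apply: tens_cat; [exact: reprP|exact: tens_refl].
Qed.

HB.instance Definition _ :=
  GRing.isZmodule.Build tens add_assoc add_comm add_0 add_opp.

Definition ptens (x : M) (y : N) : tens := \pi_tens [:: (x, y)].

Lemma tens_piE s : \pi_tens s = \sum_(p <- s) ptens p.1 p.2.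
Proof.
elim: s => [|[x y] s IH]; first by rewrite big_nil.
by rewrite big_cons -IH -cat1s pi_cat.
Qed.

Lemma tens_reprE t : t = \sum_(p <- repr t) ptens p.1 p.2.
Proof. by rewrite -tens_piE reprK. Qed.

Lemma tens_ind (P : tens -> Prop) :
  P 0 -> (forall x y t, P t -> P (ptens x y + t)) -> forall t, P t.
Proof.
move=> P0 PS t; rewrite (tens_reprE t).
by elim: (repr t) => [|p s IH]; rewrite ?big_nil ?big_cons //; apply: PS.
Qed.

Lemma ptensDl x x' y : ptens (x + x') y = ptens x y + ptens x' y.
Proof. by rewrite [RHS]/GRing.add /= -pi_cat; apply/tens_piP/tens_addl. Qed.
Lemma ptensDr x y y' : ptens x (y + y') = ptens x y + ptens x y'.
Proof. by rewrite [RHS]/GRing.add /= -pi_cat; apply/tens_piP/tens_addr. Qed.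
Lemma ptensZ a x y : ptens (a *: x) y = ptens x (a *: y).
Proof. by apply/tens_piP/tens_scale. Qed.

Definition balanced (V : zmodType) (f : M -> N -> V) : Prop :=
  [/\ forall x x' y, f (x + x') y = f x y + f x' y,
      forall x y y', f x (y + y') = f x y + f x y'
    & forall a x y, f (a *: x) y = f x (a *: y)].

(* The additive map sending x (x) y to f x y, for a balanced biadditive f; by
   tens_lift_ptens it then does not depend on the representatives used here.  *)
Definition tens_lift (V : zmodType) (f : M -> N -> V) (t : tens) : V :=
  \sum_(p <- repr t) f p.1 p.2.

Section Lift.
Variables (V : zmodType) (f : M -> N -> V).
Hypothesis bf : balanced f.

Lemma tens_rel_lift s s' : tens_rel s s' ->
  \sum_(p <- s) f p.1 p.2 = \sum_(p <- s') f p.1 p.2.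
Proof.
case: bf => fl fr fZ; elim=> //.
- by move=> s1 s2 s3 _ -> _ ->.
- by move=> s1 s1' s2 s2' _ IH1 _ IH2; rewrite !big_cat /= IH1 IH2.
- by move=> s1 s2; rewrite !big_cat /= addrC.
- by rewrite big_seq1 big_nil /=; apply: (addIr (f 0 0)); rewrite -fl !add0r.
- by move=> x x' y; rewrite !big_cons !big_nil !addr0 /= (fl, fr).
- by move=> x y y'; rewrite !big_cons !big_nil !addr0 /= (fl, fr).
- by move=> a x y; rewrite !big_seq1 fZ.
Qed.

Lemma tens_lift_pi s : tens_lift f (\pi_tens s) = \sum_(p <- s) f p.1 p.2.
Proof. exact: tens_rel_lift (reprP s). Qed.

Lemma tens_lift_ptens x y : tens_lift f (ptens x y) = f x y.
Proof. by rewrite tens_lift_pi big_seq1. Qed.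

Lemma tens_liftD t u : tens_lift f (t + u) = tens_lift f t + tens_lift f u.
Proof.
by rewrite -{1}[t]reprK -{1}[u]reprK [X in tens_lift f X]/GRing.add /= -pi_cat
           tens_lift_pi big_cat.
Qed.

Lemma tens_lift0 : tens_lift f 0 = 0.
Proof. by apply: (addIr (tens_lift f 0)); rewrite -tens_liftD !add0r. Qed.
End Lift.
End Tensor.


(* Over a Hopf algebroid whose G is not flat over R, the tensor product with G
   does not preserve submodules, and comodules have no kernels in general.    *)
Definition flat (R : comNzRingType) (M : lmodType R) : Prop :=
  forall (N N' : lmodType R) (f : {linear N -> N'}), injective f ->
    injective (tens_lift (fun (x : M) (y : N) => ptens x (f y))).

(* S as a module over R along f : R -> S. *)
Definition ralg (R S : comNzRingType) (f : {rmorphism R -> S}) : Type := S.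

Section Ralg.
Variables (R S : comNzRingType) (f : {rmorphism R -> S}).
HB.instance Definition _ := GRing.Zmodule.on (ralg f).

Definition ralg_scale (a : R) (x : ralg f) : ralg f := f a * (x : S).

Let ralg_scaleA a b x : ralg_scale a (ralg_scale b x) = ralg_scale (a * b) x.
Proof. by rewrite /ralg_scale rmorphM mulrA. Qed.
Let ralg_scale1 : left_id 1 ralg_scale.
Proof. by move=> x; rewrite /ralg_scale rmorph1 mul1r. Qed.
Let ralg_scaleDr : right_distributive ralg_scale +%R.
Proof. by move=> a x y; rewrite /ralg_scale mulrDr. Qed.
Let ralg_scaleDl x : {morph ralg_scale^~ x : a b / a + b}.
Proof. by move=> a b; rewrite /ralg_scale rmorphD mulrDl. Qed.

HB.instance Definition _ := GRing.Zmodule_isLmodule.Build R (ralg f)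
  ralg_scaleA ralg_scale1 ralg_scaleDr ralg_scaleDl.

Lemma ralgZE a (x : ralg f) : a *: x = f a * (x : S). Proof. by []. Qed.
End Ralg.

(* The tensor product of G, a right R-module along eR, and the left R-module M,
   with R acting through eL on the left factor.  Its pure tensors are ctens a x. *)
Definition cotens (R G : comNzRingType) (eL eR : {rmorphism R -> G})
  (M : lmodType R) : Type := tens (ralg eR) M.

Section Cotensor.
Variables (R G : comNzRingType) (eL eR : {rmorphism R -> G}).

Section Module.
Variable M : lmodType R.
Notation GM := (cotens eL eR M).
HB.instance Definition _ := GRing.Zmodule.on GM.

Definition ctens (a : G) (x : M) : GM := ptens (a : ralg eR) x.

Lemma ctensDl a b x : ctens (a + b) x = ctens a x + ctens b x.
Proof. exact: ptensDl. Qed.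
Lemma ctensDr a x y : ctens a (x + y) = ctens a x + ctens a y.
Proof. exact: ptensDr. Qed.
Lemma ctensZ r a x : ctens (eR r * a) x = ctens a (r *: x).
Proof. exact: (@ptensZ _ (ralg eR)). Qed.

Lemma cotens_ind (P : GM -> Prop) :
  P 0 -> (forall a x t, P t -> P (ctens a x + t)) -> forall t, P t.
Proof. by move=> P0 PS t; apply: (@tens_ind R (ralg eR) M P). Qed.

Definition cobalanced (V : zmodType) (f : G -> M -> V) : Prop :=
  [/\ forall a b x, f (a + b) x = f a x + f b x,
      forall a x y, f a (x + y) = f a x + f a y
    & forall r a x, f (eR r * a) x = f a (r *: x)].

Definition colift (V : zmodType) (f : G -> M -> V) (t : GM) : V :=
  tens_lift (f : ralg eR -> M -> V) t.

Section Lift.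
Variables (V : zmodType) (f : G -> M -> V).
Hypothesis bf : cobalanced f.
Let bf' : balanced (f : ralg eR -> M -> V).
Proof. by case: bf => h1 h2 h3; split=> // r a x; apply: h3. Qed.
Lemma colift_ctens a x : colift f (ctens a x) = f a x.
Proof. exact: tens_lift_ptens. Qed.
Lemma coliftD t u : colift f (t + u) = colift f t + colift f u.
Proof. exact: tens_liftD. Qed.
Lemma colift0 : colift f 0 = 0.
Proof. exact: tens_lift0. Qed.
End Lift.

Lemma eq_colift (V : zmodType) (f g : G -> M -> V) :
  (forall a x, f a x = g a x) -> colift f =1 colift g.
Proof. by move=> fg t; apply: eq_bigr => p _; apply: fg. Qed.

Lemma colift_id t : colift ctens t = t.
Proof. by rewrite [RHS]tens_reprE. Qed.

Definition lact (a : G) (t : GM) : GM := colift (fun b x => ctens (a * b) x) t.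

Lemma lact_balanced a : cobalanced (fun b x => ctens (a * b) x).
Proof.
split=> [b c x|b x y|r b x]; first by rewrite mulrDr ctensDl.
- by rewrite ctensDr.
- by rewrite mulrCA ctensZ.
Qed.

Lemma lact_ctens a b x : lact a (ctens b x) = ctens (a * b) x.
Proof. exact: colift_ctens (lact_balanced a) _ _. Qed.
Lemma lactDr a t u : lact a (t + u) = lact a t + lact a u.
Proof. exact: coliftD (lact_balanced a) _ _. Qed.
Lemma lact0r a : lact a 0 = 0.
Proof. exact: colift0 (lact_balanced a). Qed.
Lemma lactA a b t : lact a (lact b t) = lact (a * b) t.
Proof.
elim/cotens_ind: t => [|c x t IH]; first by rewrite !lact0r.
by rewrite !lactDr !lact_ctens mulrA IH.
Qed.
Lemma lact1 t : lact 1 t = t.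
Proof.
elim/cotens_ind: t => [|c x t IH]; first by rewrite !lact0r.
by rewrite !lactDr !lact_ctens mul1r IH.
Qed.
Lemma lactDl a b t : lact (a + b) t = lact a t + lact b t.
Proof.
elim/cotens_ind: t => [|c x t IH]; first by rewrite !lact0r addr0.
by rewrite !lactDr !lact_ctens IH mulrDl ctensDl addrACA.
Qed.

Definition cotens_scale (r : R) (t : GM) : GM := lact (eL r) t.
Let cotens_scaleA r s t :
  cotens_scale r (cotens_scale s t) = cotens_scale (r * s) t.
Proof. by rewrite /cotens_scale lactA rmorphM. Qed.
Let cotens_scale1 : left_id 1 cotens_scale.
Proof. by move=> t; rewrite /cotens_scale rmorph1 lact1. Qed.
Let cotens_scaleDr : right_distributive cotens_scale +%R.
Proof. by move=> r t u; apply: lactDr. Qed.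
Let cotens_scaleDl t : {morph cotens_scale^~ t : r s / r + s}.
Proof. by move=> r s; rewrite /cotens_scale rmorphD lactDl. Qed.

HB.instance Definition _ := GRing.Zmodule_isLmodule.Build R GM
  cotens_scaleA cotens_scale1 cotens_scaleDr cotens_scaleDl.

Lemma cotensZ r a x : r *: ctens a x = ctens (eL r * a) x.
Proof. exact: lact_ctens. Qed.
End Module.

End Cotensor.

(* The tensor product over R of two copies of the R-bimodule G, a ring. *)
Definition gamma2 (R G : comNzRingType) (eL eR : {rmorphism R -> G}) : Type :=
  cotens eL eR (ralg eL).

Section Gamma2.
Variables (R G : comNzRingType) (eL eR : {rmorphism R -> G}).
Notation GG := (gamma2 eL eR).
HB.instance Definition _ := GRing.Zmodule.on GG.

Definition gtens (a b : G) : GG := ctens eL eR a (b : ralg eL).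

Lemma gtensDl a b c : gtens (a + b) c = gtens a c + gtens b c.
Proof. exact: ctensDl. Qed.
Lemma gtensDr a b c : gtens a (b + c) = gtens a b + gtens a c.
Proof. exact: ctensDr. Qed.
Lemma gtensZ r a b : gtens (eR r * a) b = gtens a (eL r * b).
Proof. exact: (@ctensZ _ _ _ _ (ralg eL)). Qed.
Lemma gamma2_ind (P : GG -> Prop) :
  P 0 -> (forall a x t, P t -> P (gtens a x + t)) -> forall t, P t.
Proof. by move=> P0 PS t; apply: (@cotens_ind R G eL eR (ralg eL) P). Qed.

Definition gact (a b : G) (t : GG) : GG :=
  colift (fun a' (b' : ralg eL) => gtens (a * a') (b * (b' : G)))
         (t : cotens eL eR (ralg eL)).
Definition gamma2_mul (t u : GG) : GG :=
  colift (fun a (b : ralg eL) => gact a b u) (t : cotens eL eR (ralg eL)).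

Let gact_bal a b :
  @cobalanced _ _ eR (ralg eL) _ (fun a' (b' : ralg eL) => gtens (a * a') (b * (b' : G))).
Proof.
split=> [c d x|c x y|r c x]; first by rewrite mulrDr gtensDl.
- by rewrite [X in gtens _ X]mulrDr gtensDr.
- by rewrite mulrCA gtensZ ralgZE mulrCA.
Qed.
Let gactE a b a' b' : gact a b (gtens a' b') = gtens (a * a') (b * b').
Proof. exact: (colift_ctens eL (gact_bal a b)). Qed.
Let gactD a b t u : gact a b (t + u) = gact a b t + gact a b u.
Proof. exact: (coliftD (gact_bal a b)). Qed.
Let gact0 a b : gact a b 0 = 0.
Proof. exact: (colift0 eL (gact_bal a b)). Qed.

Let mul_bal u : @cobalanced _ _ eR (ralg eL) _ (fun a (b : ralg eL) => gact a b u).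
Proof.
split=> [c d x|c x y|r c x]; elim/gamma2_ind: u => [|a b t IH];
  rewrite ?gact0 ?addr0 // !gactD !gactE IH.
- by rewrite mulrDl gtensDl addrACA.
- by rewrite mulrDl gtensDr addrACA.
- by rewrite ralgZE -!mulrA gtensZ.
Qed.
Let mulE a b u : gamma2_mul (gtens a b) u = gact a b u.
Proof. exact: (colift_ctens eL (mul_bal u)). Qed.
Let mulDl t t' u : gamma2_mul (t + t') u = gamma2_mul t u + gamma2_mul t' u.
Proof. exact: (coliftD (mul_bal u)). Qed.
Let mul0l u : gamma2_mul 0 u = 0.
Proof. exact: (colift0 eL (mul_bal u)). Qed.

Let mulDr t u u' : gamma2_mul t (u + u') = gamma2_mul t u + gamma2_mul t u'.
Proof.
elim/gamma2_ind: t => [|a b t IH]; first by rewrite !mul0l addr0.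
by rewrite !mulDl IH !mulE gactD addrACA.
Qed.
Let mul0r t : gamma2_mul t 0 = 0.
Proof.
elim/gamma2_ind: t => [|a b t IH]; first by rewrite mul0l.
by rewrite mulDl IH mulE gact0 addr0.
Qed.

Let mulA : associative gamma2_mul.
Proof.
move=> t u v; elim/gamma2_ind: t => [|a b t IH]; first by rewrite !mul0l.
rewrite !mulDl IH; congr (_ + _) => {t IH}.
elim/gamma2_ind: u => [|c d u IH]; first by rewrite !(mul0l, mul0r).
rewrite !(mulDl, mulDr) IH; congr (_ + _) => {u IH}.
elim/gamma2_ind: v => [|e f v IH]; first by rewrite !mul0r.
by rewrite !mulDr IH !(mulE, gactE) !mulrA.
Qed.
Let mulC : commutative gamma2_mul.
Proof.
move=> t u; elim/gamma2_ind: t => [|a b t IH]; first by rewrite mul0l mul0r.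
rewrite mulDl mulDr IH; congr (_ + _) => {t IH}.
elim/gamma2_ind: u => [|c d u IH]; first by rewrite mul0l mul0r.
by rewrite mulDl mulDr IH !mulE !gactE (mulrC a) (mulrC b).
Qed.
Let mul1 : left_id (gtens 1 1) gamma2_mul.
Proof.
elim/gamma2_ind=> [|a b t IH]; first by rewrite mul0r.
by rewrite mulDr IH mulE gactE !mul1r.
Qed.

HB.instance Definition _ :=
  GRing.Zmodule_isComPzRing.Build GG mulA mulC mul1 mulDl.

Lemma gtensM a b a' b' : gtens a b * gtens a' b' = gtens (a * a') (b * b').
Proof. exact: etrans (mulE _ _ _) (gactE _ _ _ _). Qed.
End Gamma2.

Section Ideals.
Variable R : comNzRingType.

Definition ideal_gen (A : set R) : {pred R} := fun x =>
  `[< exists2 s : seq (R * R), (forall p, p \in s -> A p.2)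
                             & x = \sum_(p <- s) p.1 * p.2 >].

Lemma ideal_genP (A : set R) x :
  reflect (exists2 s : seq (R * R), (forall p, p \in s -> A p.2)
                                  & x = \sum_(p <- s) p.1 * p.2)
          (x \in ideal_gen A).
Proof. exact: asboolP. Qed.

Lemma mem_ideal_gen (A : set R) a x : A x -> a * x \in ideal_gen A.
Proof.
move=> Ax; apply/ideal_genP; exists [:: (a, x)]; last by rewrite big_seq1.
by move=> p /[!inE] /eqP ->.
Qed.

Lemma ideal_gen0 (A : set R) : 0 \in ideal_gen A.
Proof. by apply/ideal_genP; exists [::]; rewrite ?big_nil. Qed.

Lemma ideal_gen_lin (A : set R) a :
  {in ideal_gen A &, forall x y, a * x + y \in ideal_gen A}.
Proof.
move=> _ _ /ideal_genP[s sA ->] /ideal_genP[t tA ->]; apply/ideal_genP.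
exists ([seq (a * p.1, p.2) | p <- s] ++ t).
  by move=> p; rewrite mem_cat => /orP[/mapP[q qs ->]|]; [exact: (sA q)|exact: tA].
rewrite big_cat big_map mulr_sumr /=; congr (_ + _).
by apply: eq_bigr => p _; rewrite mulrA.
Qed.

(* The powers of an ideal, from the zeroth one, which is R. *)
Fixpoint ideal_exp (I : {pred R}) (k : nat) : {pred R} :=
  if k is k'.+1
  then ideal_gen [set z | exists x y, [/\ x \in I, y \in ideal_exp I k' & z = x * y]]
  else predT.
End Ideals.

(* The ideals of R are the submodules of R^o. *)
Definition noetherian (R : comNzRingType) : Prop :=
  forall I : submodClosed R^o, exists s : seq R,
    forall x : R, (x \in I) = (x \in ideal_gen [set` s]).

HB.mixin Record isMaximalIdealr (R : comNzRingType) (S : R -> bool) := {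
  maximal_idealr_subproof :
    forall J : idealr R, (forall x, S x -> x \in J) -> (forall x, x \in J -> S x)
}.
#[short(type="maximal_idealr")]
HB.structure Definition MaximalIdealr (R : comNzRingType) :=
  {S of Idealr R S & isMaximalIdealr R S}.

Definition local_with (R : comNzRingType) (m : maximal_idealr R) : Prop :=
  forall n : maximal_idealr R, n =i m.

Definition residue (R : comNzRingType) (m : maximal_idealr R) : Type :=
  {ideal_quot m}.

Section Residue.
Variables (R : comNzRingType) (m : maximal_idealr R).
Notation K := (residue m).
HB.instance Definition _ := GRing.ComNzRing.on K.

Definition to_residue : R -> K := \pi_({ideal_quot m}).
HB.instance Definition _ := GRing.RMorphism.on to_residue.

Lemma to_residueP (x : K) : exists a, x = to_residue a.
Proof. by exists (repr x); rewrite /to_residue reprK. Qed.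

Lemma to_residue_eq0 a : (to_residue a == 0) = (a \in m).
Proof. by rewrite -[0](rmorph0 to_residue) -Quotient.idealrBE subr0. Qed.

Lemma residue_unit (x : K) : x != 0 -> exists y : K, y * x = 1.
Proof.
have [a ->] := to_residueP x; rewrite to_residue_eq0 => am.
pose J : {pred R} := fun z => `[< exists b c, c \in m /\ z = b * a + c >].
have [J1|J1] := boolP (1 \in J).
  have /asboolP[b [c [cm e]]] := J1; exists (to_residue b).
  rewrite -rmorphM; apply/eqP; rewrite -subr_eq0.
  rewrite -[X in _ - X](rmorph1 to_residue) -rmorphB to_residue_eq0 e.
  by rewrite opprD addNKr rpredN.
have Jid : idealr_closed J.
  split=> //; first by apply/asboolP; exists 0, 0; rewrite rpred0 mul0r addr0.
  move=> d _ _ /asboolP[b [c [cm ->]]] /asboolP[b' [c' [cm' ->]]].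
  apply/asboolP; exists (d * b + b'), (d * c + c'); split.
    by rewrite rpredD ?idealMr.
  by rewrite mulrDr mulrDl addrACA mulrA.
pose J' : idealr R := HB.pack J (isIdealr.Build R J Jid).
case/negP: am; apply: (@maximal_idealr_subproof _ m J').
  move=> z zm; apply/asboolP; exists 0, z; by rewrite mul0r add0r.
by apply/asboolP; exists 1, 0; rewrite rpred0 mul1r addr0.
Qed.

Definition residue_inv (x : K) : K :=
  if pselect (exists y : K, y * x = 1) is left h then projT1 (cid h) else 0.
Let residue_mulVf (x : K) : x != 0 -> residue_inv x * x = 1.
Proof.
move=> /residue_unit h; rewrite /residue_inv; case: pselect => // h'.
exact: projT2 (cid h').
Qed.
Let residue_inv0 : residue_inv 0 = 0.
Proof.
have h : ~ exists y : K, y * 0 = 1.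
  by case=> y /eqP; rewrite mulr0 eq_sym oner_eq0.
by rewrite /residue_inv; case: pselect.
Qed.
HB.instance Definition _ :=
  GRing.ComNzRing_isField.Build K residue_mulVf residue_inv0.
End Residue.

(* The morphism induced by g on the quotient by an ideal that g annihilates. *)
Section QuotLift.
Variables (A : comNzRingType) (B : comPzRingType) (I : idealr A).
Variables (g : {rmorphism A -> B}) (gI : forall x, x \in I -> g x = 0).

Definition quot_lift (x : {ideal_quot I}) : B := let _ := gI in g (repr x).

Lemma quot_lift_pi a : quot_lift (\pi_({ideal_quot I}) a) = g a.
Proof.
rewrite /quot_lift; apply/eqP; rewrite -subr_eq0 -rmorphB; apply/eqP/gI.
by rewrite Quotient.idealrBE reprK.
Qed.

Let quot_lift_zmod : zmod_morphism quot_lift.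
Proof.
move=> x y; rewrite -[x]reprK -[y]reprK -rmorphB !quot_lift_pi.
exact: rmorphB.
Qed.
Let quot_lift_monoid : monoid_morphism quot_lift.
Proof.
split; first by rewrite -[1](rmorph1 \pi_({ideal_quot I})) quot_lift_pi rmorph1.
move=> x y; rewrite -[x]reprK -[y]reprK -rmorphM !quot_lift_pi.
exact: rmorphM.
Qed.
HB.instance Definition _ :=
  GRing.isZmodMorphism.Build _ _ quot_lift quot_lift_zmod.
HB.instance Definition _ :=
  GRing.isMonoidMorphism.Build _ _ quot_lift quot_lift_monoid.
End QuotLift.

Section Coassociativity.
Variables (R G : comNzRingType) (eL eR : {rmorphism R -> G}) (M : lmodType R).

(* (a (x) b) (x) x |-> a (x) (b (x) x). *)
Definition assoc_tens (t : gamma2 eL eR) (x : M) : cotens eL eR (cotens eL eR M) :=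
  colift (fun a (b : ralg eL) => ctens eL eR a (ctens eL eR (b : G) x))
         (t : cotens eL eR (ralg eL)).

Definition coassociative (psi : G -> gamma2 eL eR) (rho : M -> cotens eL eR M) :=
  forall x, colift (fun a y => ctens eL eR a (rho y)) (rho x)
          = colift (fun a y => assoc_tens (psi a) y) (rho x).
End Coassociativity.

(* The sum of e over coprod a = \sum b (x) c is written
   colift (fun b c => e) (coprod a), where c is tagged as an element of the
   left R-module ralg etaL.                                                   *)
Record hopf_algebroid (R G : comNzRingType) := HopfAlgebroid {
  etaL : {rmorphism R -> G};
  etaR : {rmorphism R -> G};
  counit : {rmorphism G -> R};
  coprod : {rmorphism G -> gamma2 etaL etaR};
  antip : {rmorphism G -> G};
  counit_etaL : forall r, counit (etaL r) = r;
  counit_etaR : forall r, counit (etaR r) = r;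
  coprod_etaL : forall r, coprod (etaL r) = gtens etaL etaR (etaL r) 1;
  coprod_etaR : forall r, coprod (etaR r) = gtens etaL etaR 1 (etaR r);
  coprod_counitl : forall a,
    colift (fun b (c : ralg etaL) => etaL (counit b) * (c : G))
           (coprod a : cotens etaL etaR (ralg etaL)) = a;
  coprod_counitr : forall a,
    colift (fun b (c : ralg etaL) => b * etaR (counit c))
           (coprod a : cotens etaL etaR (ralg etaL)) = a;
  coprodA : @coassociative R G etaL etaR (ralg etaL) coprod coprod;
  antip_etaL : forall r, antip (etaL r) = etaR r;
  antip_etaR : forall r, antip (etaR r) = etaL r;
  antipK : forall a, antip (antip a) = a;
  antip_mull : forall a,
    colift (fun b (c : ralg etaL) => antip b * (c : G))
           (coprod a : cotens etaL etaR (ralg etaL)) = etaR (counit a);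
  antip_mulr : forall a,
    colift (fun b (c : ralg etaL) => b * antip c)
           (coprod a : cotens etaL etaR (ralg etaL)) = etaL (counit a)
}.

Section Comodules.
Variables (R G : comNzRingType) (H : hopf_algebroid R G).

Record comodule (M : lmodType R) := Comodule {
  coact :> {linear M -> cotens (etaL H) (etaR H) M};
  coact_counit : forall x, colift (fun a y => counit H a *: y) (coact x) = x;
  coactA : coassociative (coprod H) coact
}.

Definition primitive (M : lmodType R) (rho : comodule M) (x : M) : Prop :=
  rho x = ctens (etaL H) (etaR H) 1 x.

Definition comodule_hom (M N : lmodType R) (rhoM : comodule M) (rhoN : comodule N)
    (f : {linear M -> N}) : Prop :=
  forall x, rhoN (f x) = colift (fun a y => ctens (etaL H) (etaR H) a (f y)) (rhoM x).

Definition comodule_iso (M N : lmodType R) (rhoM : comodule M) (rhoN : comodule N) :=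
  exists2 f : {linear M -> N}, bijective f & comodule_hom rhoM rhoN f.
End Comodules.

Definition fin_gen (R : comNzRingType) (M : lmodType R) : Prop :=
  exists s : seq M, forall x, exists c : M -> R, x = \sum_(y <- s) c y *: y.

Definition unipotent (k : fieldType) (S : comNzRingType) (H : hopf_algebroid k S) :=
  forall (V : lmodType k) (rho : comodule H V),
    fin_gen V -> (exists x : V, x != 0) ->
    exists2 x : V, x != 0 & primitive rho x.

Definition discrete (R : comNzRingType) (m : {pred R}) (M : lmodType R) : Prop :=
  forall x : M, exists2 k : nat, (1 <= k)%N &
    forall a, a \in ideal_exp m k -> a *: x = 0.

Section Balance.
Variables (R G : comNzRingType) (eL eR : {rmorphism R -> G}).
Notation GG := (gamma2 eL eR).

Section Assoc.
Variable M : lmodType R.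
Let bal (x : M) : @cobalanced R G eR (ralg eL) _
  (fun a (b : ralg eL) => ctens eL eR a (ctens eL eR (b : G) x)).
Proof.
split=> [a b c|a b c|r a b]; first by rewrite ctensDl.
- by rewrite -ctensDr -ctensDl.
- by rewrite ctensZ cotensZ ralgZE.
Qed.
Lemma assoc_gtens a b (x : M) :
  assoc_tens (gtens eL eR a b) x = ctens eL eR a (ctens eL eR b x).
Proof. exact: (colift_ctens eL (bal x)). Qed.
Lemma assoc_tensDl (t u : GG) (x : M) :
  assoc_tens (t + u) x = assoc_tens t x + assoc_tens u x.
Proof. exact: (coliftD (bal x)). Qed.
Lemma assoc_tens0l (x : M) : assoc_tens (0 : GG) x = 0.
Proof. exact: (colift0 eL (bal x)). Qed.
Lemma assoc_tensDr (t : GG) (x y : M) :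
  assoc_tens t (x + y) = assoc_tens t x + assoc_tens t y.
Proof.
elim/gamma2_ind: t => [|a b t IH]; first by rewrite !assoc_tens0l addr0.
by rewrite !assoc_tensDl IH !assoc_gtens !ctensDr addrACA.
Qed.
Lemma assoc_tensZ r (t : GG) (x : M) :
  assoc_tens (gtens eL eR 1 (eR r) * t) x = assoc_tens t (r *: x).
Proof.
elim/gamma2_ind: t => [|a b t IH]; first by rewrite mulr0 !assoc_tens0l.
by rewrite mulrDr !assoc_tensDl IH gtensM mul1r !assoc_gtens ctensZ.
Qed.

Lemma assoc_balanced (psi : {rmorphism G -> GG}) :
  (forall r, psi (eR r) = gtens eL eR 1 (eR r)) ->
  cobalanced eR (fun a (x : M) => assoc_tens (psi a) x).
Proof.
move=> psiR; split=> [a b x|a x y|r a x].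
- by rewrite rmorphD assoc_tensDl.
- by rewrite assoc_tensDr.
- by rewrite rmorphM psiR assoc_tensZ.
Qed.

Lemma coact_balanced (N : lmodType R) (f : M -> cotens eL eR N) :
  (forall x y, f (x + y) = f x + f y) -> (forall r x, f (r *: x) = r *: f x) ->
  cobalanced eR (fun a x => ctens eL eR a (f x)).
Proof.
move=> fD fZ; split=> [a b x|a x y|r a x]; first by rewrite ctensDl.
- by rewrite fD ctensDr.
- by rewrite ctensZ fZ.
Qed.
End Assoc.

Lemma gamma2_scaleE r (t : GG) :
  gtens eL eR (eL r) 1 * t = r *: (t : cotens eL eR (ralg eL)) :> GG.
Proof.
elim/gamma2_ind: t => [|a b t IH].
  by rewrite mulr0; symmetry; apply: (scaler0 (cotens eL eR (ralg eL)) r).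
rewrite mulrDr IH gtensM mul1r -[gtens eL eR (eL r * a) b]cotensZ.
by symmetry; apply: (scalerDr r (gtens eL eR a b : cotens eL eR (ralg eL))).
Qed.

Lemma coprod_balanced (psi : {rmorphism G -> GG}) :
  (forall r, psi (eL r) = gtens eL eR (eL r) 1) ->
  cobalanced eR (fun a (b : ralg eL) =>
    ctens eL eR a (psi (b : G) : cotens eL eR (ralg eL))).
Proof.
move=> psiL; apply: coact_balanced => [x y|r x]; first exact: (rmorphD psi (x : G) y).
by rewrite ralgZE rmorphM psiL gamma2_scaleE.
Qed.
End Balance.

Section QuotientHopfAlgebroid.
Variables (R G : comNzRingType) (H : hopf_algebroid R G).

(* m G and G m. *)
Definition extL (m : {pred R}) : {pred G} := ideal_gen [set etaL H r | r in [set` m]].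
Definition extR (m : {pred R}) : {pred G} := ideal_gen [set etaR H r | r in [set` m]].

Definition invariant_ideal (m : {pred R}) : Prop := extL m =i extR m.

Section ExtIdeal.
Variable m : maximal_idealr R.

Lemma extL_kill (B : comPzRingType) (g : {rmorphism G -> B}) :
  (forall r, r \in m -> g (etaL H r) = 0) -> forall x, x \in extL m -> g x = 0.
Proof.
move=> gm _ /ideal_genP[s sP ->]; rewrite rmorph_sum big1_seq //= => p ps.
by have [r rm <-] := sP p ps; rewrite rmorphM gm ?mulr0.
Qed.

Let extL_ideal : idealr_closed (extL m).
Proof.
split; [exact: ideal_gen0| |exact: ideal_gen_lin].
apply/negP => h1.
have := @extL_kill _ (to_residue m \o counit H) _ 1 h1; rewrite rmorph1.
move=> h; have /eqP := oner_neq0 (residue m); apply; apply: h => r rm /=.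
by apply/eqP; rewrite counit_etaL to_residue_eq0.
Qed.
HB.instance Definition _ := isIdealr.Build G (extL m) extL_ideal.
End ExtIdeal.

Section Quotient.
Variables (m : maximal_idealr R) (inv : invariant_ideal m).

(* G / m G, and the Hopf algebroid structure of (R / m, G / m G). *)
Definition quot_gamma : Type := {ideal_quot (extL m)}.
HB.instance Definition _ := GRing.ComNzRing.on quot_gamma.
Definition to_quot_gamma : G -> quot_gamma := \pi_({ideal_quot (extL m)}).
HB.instance Definition _ := GRing.RMorphism.on to_quot_gamma.

Notation K := (residue m).
Notation S := quot_gamma.
Notation p0 := (to_residue m).
Notation p1 := to_quot_gamma.

Lemma to_quot_gammaP (x : S) : exists a, x = p1 a.
Proof. by exists (repr x); rewrite /to_quot_gamma reprK. Qed.
Lemma to_quot_gamma0 a : a \in extL m -> p1 a = 0.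
Proof.
move=> am; apply/eqP; rewrite -[0](rmorph0 to_quot_gamma).
by rewrite -Quotient.idealrBE subr0.
Qed.

Let p1M a b : p1 (a * b) = p1 a * p1 b. Proof. exact: rmorphM. Qed.

Lemma etaL_ext r : r \in m -> etaL H r \in extL m.
Proof. by move=> rm; rewrite -[_ r]mul1r; apply: mem_ideal_gen; exists r. Qed.
Lemma etaR_ext r : r \in m -> etaR H r \in extL m.
Proof.
by move=> rm; rewrite inv -[_ r]mul1r; apply: mem_ideal_gen; exists r.
Qed.

Let etaL_kill r : r \in m -> (p1 \o etaL H) r = 0.
Proof. by move=> rm; apply/to_quot_gamma0/etaL_ext. Qed.
Let etaR_kill r : r \in m -> (p1 \o etaR H) r = 0.
Proof. by move=> rm; apply/to_quot_gamma0/etaR_ext. Qed.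

Definition qetaL : {rmorphism K -> S} := quot_lift etaL_kill.
Definition qetaR : {rmorphism K -> S} := quot_lift etaR_kill.

Lemma qetaLE r : qetaL (p0 r) = p1 (etaL H r).
Proof. exact: quot_lift_pi. Qed.
Lemma qetaRE r : qetaR (p0 r) = p1 (etaR H r).
Proof. exact: quot_lift_pi. Qed.

Let counit_kill x : x \in extL m -> (p0 \o counit H) x = 0.
Proof.
apply: extL_kill => r rm /=; rewrite counit_etaL; apply/eqP.
by rewrite to_residue_eq0.
Qed.
Definition qcounit : {rmorphism S -> K} := quot_lift counit_kill.
Lemma qcounitE a : qcounit (p1 a) = p0 (counit H a).
Proof. exact: quot_lift_pi. Qed.

Let antip_kill x : x \in extL m -> (p1 \o antip H) x = 0.
Proof.
apply: extL_kill => r rm /=; rewrite antip_etaL; exact: (etaR_kill rm).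
Qed.
Definition qantip : {rmorphism S -> S} := quot_lift antip_kill.
Lemma qantipE a : qantip (p1 a) = p1 (antip H a).
Proof. exact: quot_lift_pi. Qed.

Notation GG := (gamma2 (etaL H) (etaR H)).
Notation SS := (gamma2 qetaL qetaR).

Definition to_quot_gamma2 (t : GG) : SS :=
  colift (fun a (b : ralg (etaL H)) => gtens qetaL qetaR (p1 a) (p1 (b : G)))
         (t : cotens (etaL H) (etaR H) (ralg (etaL H))).
Notation p2 := to_quot_gamma2.

Let p2_bal : @cobalanced R G (etaR H) (ralg (etaL H)) _
  (fun a (b : ralg (etaL H)) => gtens qetaL qetaR (p1 a) (p1 (b : G))).
Proof.
split=> [a b x|a x y|r a x]; first by rewrite rmorphD gtensDl.
- by rewrite rmorphD gtensDr.
- by rewrite p1M -qetaRE gtensZ qetaLE -p1M.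
Qed.
Lemma to_quot_gamma2E a b :
  p2 (gtens (etaL H) (etaR H) a b) = gtens qetaL qetaR (p1 a) (p1 b).
Proof. exact: (colift_ctens _ p2_bal). Qed.
Let p2D t u : p2 (t + u) = p2 t + p2 u.
Proof. exact: (coliftD p2_bal). Qed.
Let p2_0 : p2 0 = 0.
Proof. exact: (colift0 _ p2_bal). Qed.

Let p2_zmod : zmod_morphism p2.
Proof. by move=> t u; apply: (addIr (p2 u)); rewrite -p2D !subrK. Qed.
Let p2_monoid : monoid_morphism p2.
Proof.
split; first by rewrite to_quot_gamma2E !rmorph1.
move=> t u; elim/gamma2_ind: t => [|a b t IH]; first by rewrite mul0r p2_0 mul0r.
rewrite mulrDl !p2D mulrDl IH; congr (_ + _) => {t IH}.
elim/gamma2_ind: u => [|c d u IH]; first by rewrite mulr0 p2_0 mulr0.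
by rewrite mulrDr !p2D mulrDr IH gtensM !to_quot_gamma2E gtensM !rmorphM.
Qed.
HB.instance Definition _ := GRing.isZmodMorphism.Build _ _ p2 p2_zmod.
HB.instance Definition _ := GRing.isMonoidMorphism.Build _ _ p2 p2_monoid.

Let coprod_kill x : x \in extL m -> (p2 \o coprod H) x = 0.
Proof.
apply: extL_kill => r rm; rewrite /= coprod_etaL to_quot_gamma2E.
have /= -> := etaL_kill rm; apply: (addIr (gtens qetaL qetaR 0 (p1 1))).
by rewrite -gtensDl !add0r.
Qed.
Definition qcoprod : {rmorphism S -> SS} := quot_lift coprod_kill.
Lemma qcoprodE a : qcoprod (p1 a) = p2 (coprod H a).
Proof. exact: quot_lift_pi. Qed.

Let qsplit (P : S -> Prop) : (forall a, P (p1 a)) -> forall x, P x.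
Proof. by move=> h x; have [a ->] := to_quot_gammaP x. Qed.
Let ksplit (P : K -> Prop) : (forall r, P (p0 r)) -> forall x, P x.
Proof. by move=> h x; have [a ->] := to_residueP x. Qed.
Let p1_1 : p1 1 = 1. Proof. exact: rmorph1. Qed.
Let p1D a b : p1 (a + b) = p1 a + p1 b. Proof. exact: rmorphD. Qed.
Let p1_0 : p1 0 = 0. Proof. exact: rmorph0. Qed.

(* colift over the quotient, evaluated on p2 t, for maps compatible with p1. *)
Let colift_p2 (f : G -> ralg (etaL H) -> G) (g : S -> ralg qetaL -> S) :
  cobalanced (etaR H) f -> cobalanced qetaR g ->
  (forall a b, g (p1 a) (p1 b) = p1 (f a b)) ->
  forall t : GG, colift g (p2 t : cotens qetaL qetaR (ralg qetaL))
     = p1 (colift f (t : cotens (etaL H) (etaR H) (ralg (etaL H)))).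
Proof.
move=> bf bg fg; elim/gamma2_ind => [|a b t IH].
  by rewrite p2_0 (colift0 _ bf) p1_0; apply: (colift0 _ bg).
rewrite p2D (coliftD bf) p1D -IH to_quot_gamma2E.
rewrite (colift_ctens _ bf) -fg.
apply: etrans (coliftD bg _ _) _; congr (_ + _).
exact: (colift_ctens _ bg).
Qed.

Let qcounit_etaL x : qcounit (qetaL x) = x.
Proof. by elim/ksplit: x => r; rewrite qetaLE qcounitE counit_etaL. Qed.
Let qcounit_etaR x : qcounit (qetaR x) = x.
Proof. by elim/ksplit: x => r; rewrite qetaRE qcounitE counit_etaR. Qed.
Let qantip_etaL x : qantip (qetaL x) = qetaR x.
Proof. by elim/ksplit: x => r; rewrite qetaLE qantipE antip_etaL qetaRE. Qed.
Let qantip_etaR x : qantip (qetaR x) = qetaL x.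
Proof. by elim/ksplit: x => r; rewrite qetaRE qantipE antip_etaR qetaLE. Qed.
Let qantipK x : qantip (qantip x) = x.
Proof. by elim/qsplit: x => a; rewrite !qantipE antipK. Qed.
Let qcoprod_etaL x : qcoprod (qetaL x) = gtens qetaL qetaR (qetaL x) 1.
Proof.
by elim/ksplit: x => r; rewrite qetaLE qcoprodE coprod_etaL to_quot_gamma2E p1_1.
Qed.
Let qcoprod_etaR x : qcoprod (qetaR x) = gtens qetaL qetaR 1 (qetaR x).
Proof.
by elim/ksplit: x => r; rewrite qetaRE qcoprodE coprod_etaR to_quot_gamma2E p1_1.
Qed.

Let counitl_bal (R' G' : comNzRingType) (L E : {rmorphism R' -> G'})
  (e : {rmorphism G' -> R'}) : (forall r, e (E r) = r) ->
  cobalanced E (fun b (c : ralg L) => L (e b) * (c : G') : G').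
Proof.
move=> eE; split=> [a b x|a x y|r a x].
- by rewrite !rmorphD mulrDl.
- by rewrite -mulrDr.
- by rewrite !rmorphM eE ralgZE mulrAC mulrC mulrA [X in X * x]mulrC.
Qed.
Let counitr_bal (R' G' : comNzRingType) (L E : {rmorphism R' -> G'})
  (e : {rmorphism G' -> R'}) : (forall r, e (L r) = r) ->
  cobalanced E (fun b (c : ralg L) => b * E (e (c : G')) : G').
Proof.
move=> eL; split=> [a b x|a x y|r a x].
- by rewrite mulrDl.
- by rewrite !rmorphD mulrDr.
- by rewrite ralgZE !rmorphM eL mulrCA mulrA.
Qed.
Let mull_bal (R' G' : comNzRingType) (L E : {rmorphism R' -> G'})
  (c : {rmorphism G' -> G'}) : (forall r, c (E r) = L r) ->
  cobalanced E (fun b (x : ralg L) => c b * (x : G') : G').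
Proof.
move=> cE; split=> [a b x|a x y|r a x].
- by rewrite !rmorphD mulrDl.
- by rewrite -mulrDr.
- by rewrite !rmorphM cE ralgZE -mulrA mulrCA.
Qed.
Let mulr_bal (R' G' : comNzRingType) (L E : {rmorphism R' -> G'})
  (c : {rmorphism G' -> G'}) : (forall r, c (L r) = E r) ->
  cobalanced E (fun b (x : ralg L) => b * c (x : G') : G').
Proof.
move=> cL; split=> [a b x|a x y|r a x].
- by rewrite mulrDl.
- by rewrite !rmorphD mulrDr.
- by rewrite ralgZE !rmorphM cL mulrCA mulrA.
Qed.

Let qcounitl a : colift (fun b (c : ralg qetaL) => qetaL (qcounit b) * (c : S))
  (qcoprod a : cotens qetaL qetaR (ralg qetaL)) = a.
Proof.
elim/qsplit: a => a; rewrite qcoprodE -[X in _ = p1 X](coprod_counitl H).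
apply: colift_p2 => [||b c]; [exact/counitl_bal/counit_etaR|exact: counitl_bal|].
by rewrite qcounitE qetaLE -p1M.
Qed.
Let qcounitr a : colift (fun b (c : ralg qetaL) => b * qetaR (qcounit (c : S)))
  (qcoprod a : cotens qetaL qetaR (ralg qetaL)) = a.
Proof.
elim/qsplit: a => a; rewrite qcoprodE -[X in _ = p1 X](coprod_counitr H).
apply: colift_p2 => [||b c]; [exact/counitr_bal/counit_etaL|exact: counitr_bal|].
by rewrite qcounitE qetaRE -p1M.
Qed.
Let qmull a : colift (fun b (c : ralg qetaL) => qantip b * (c : S))
  (qcoprod a : cotens qetaL qetaR (ralg qetaL)) = qetaR (qcounit a).
Proof.
elim/qsplit: a => a; rewrite qcoprodE qcounitE qetaRE -antip_mull.
apply: colift_p2 => [||b c]; [exact/mull_bal/antip_etaR|exact: mull_bal|].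
by rewrite qantipE -p1M.
Qed.
Let qmulr a : colift (fun b (c : ralg qetaL) => b * qantip (c : S))
  (qcoprod a : cotens qetaL qetaR (ralg qetaL)) = qetaL (qcounit a).
Proof.
elim/qsplit: a => a; rewrite qcoprodE qcounitE qetaLE -antip_mulr.
apply: colift_p2 => [||b c]; [exact/mulr_bal/antip_etaL|exact: mulr_bal|].
by rewrite qantipE -p1M.
Qed.

Notation GGG := (cotens (etaL H) (etaR H) (cotens (etaL H) (etaR H) (ralg (etaL H)))).
Notation SSS := (cotens qetaL qetaR (cotens qetaL qetaR (ralg qetaL))).
Let p3 (t : GGG) : SSS :=
  colift (fun a (u : GG) => ctens qetaL qetaR (p1 a)
                              (p2 u : cotens qetaL qetaR (ralg qetaL))) t.
Let p2Z r (t : cotens (etaL H) (etaR H) (ralg (etaL H))) :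
  p2 (r *: t) = p0 r *: (p2 t : cotens qetaL qetaR (ralg qetaL)).
Proof.
elim/(@gamma2_ind R G (etaL H) (etaR H)): t => [|a b t IH].
  by rewrite scaler0 p2_0 scaler0.
rewrite scalerDr !p2D scalerDr IH; congr (_ + _).
rewrite cotensZ !to_quot_gamma2E p1M -qetaLE; symmetry; exact: cotensZ.
Qed.
Let p3_bal : cobalanced (etaR H) (fun a (u : cotens (etaL H) (etaR H) (ralg (etaL H))) =>
  ctens qetaL qetaR (p1 a) (p2 u : cotens qetaL qetaR (ralg qetaL))).
Proof.
split=> [a b x|a x y|r a x].
- by rewrite p1D ctensDl.
- by rewrite p2D ctensDr.
- by rewrite p1M -qetaRE ctensZ p2Z.
Qed.
Let p3E a u : p3 (ctens _ _ a u) = ctens qetaL qetaR (p1 a) (p2 u).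
Proof. exact: (colift_ctens _ p3_bal). Qed.
Let p3D t u : p3 (t + u) = p3 t + p3 u.
Proof. exact: (coliftD p3_bal). Qed.
Let p3_0 : p3 0 = 0.
Proof. exact: (colift0 _ p3_bal). Qed.

Let assoc_p2 (u : GG) (b : G) :
  @assoc_tens _ _ qetaL qetaR (ralg qetaL) (p2 u) (p1 b) =
  p3 (@assoc_tens _ _ _ _ (ralg (etaL H)) u b).
Proof.
elim/gamma2_ind: u => [|c d u IH]; first by rewrite p2_0 !assoc_tens0l p3_0.
rewrite p2D !assoc_tensDl p3D -IH; congr (_ + _).
rewrite to_quot_gamma2E !assoc_gtens p3E; congr ctens.
by symmetry; apply: to_quot_gamma2E.
Qed.

Let qcoprodA : @coassociative _ _ qetaL qetaR (ralg qetaL) qcoprod qcoprod.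
Proof.
elim/qsplit=> a; rewrite [qcoprod _]qcoprodE.
have lbal := coprod_balanced (@coprod_etaL _ _ H).
have rbal := @assoc_balanced _ _ _ _ (ralg (etaL H)) _ (@coprod_etaR _ _ H).
have lbal' := coprod_balanced qcoprod_etaL.
have rbal' := @assoc_balanced _ _ _ _ (ralg qetaL) _ qcoprod_etaR.
have L (t : GG) : colift (fun b (c : ralg qetaL) => ctens qetaL qetaR b
        (qcoprod c : cotens qetaL qetaR (ralg qetaL)))
      (p2 t : cotens qetaL qetaR (ralg qetaL)) =
    p3 (colift (fun b (c : ralg (etaL H)) => ctens (etaL H) (etaR H) b
        (coprod H c : cotens (etaL H) (etaR H) (ralg (etaL H))))
      (t : cotens (etaL H) (etaR H) (ralg (etaL H)))).
  elim/gamma2_ind: t => [|b c t IH].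
    rewrite p2_0 (colift0 _ lbal) p3_0; exact: (colift0 _ lbal').
  rewrite p2D to_quot_gamma2E (coliftD lbal) p3D -IH (colift_ctens _ lbal) p3E.
  apply: etrans (coliftD lbal' _ _) _; congr (_ + _).
  by apply: etrans (colift_ctens _ lbal' _ _) _; rewrite qcoprodE.
have Q (t : GG) : colift (fun b (c : ralg qetaL) => assoc_tens (qcoprod b) c)
      (p2 t : cotens qetaL qetaR (ralg qetaL)) =
    p3 (colift (fun b (c : ralg (etaL H)) => assoc_tens (coprod H b) c)
      (t : cotens (etaL H) (etaR H) (ralg (etaL H)))).
  elim/gamma2_ind: t => [|b c t IH].
    rewrite p2_0 (colift0 _ rbal) p3_0; exact: (colift0 _ rbal').
  rewrite p2D to_quot_gamma2E (coliftD rbal) p3D -IH (colift_ctens _ rbal).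
  apply: etrans (coliftD rbal' _ _) _; congr (_ + _).
  apply: etrans (colift_ctens _ rbal' _ _) _.
  by rewrite qcoprodE; exact: assoc_p2.
apply: etrans (L _) _; apply: etrans _ (esym (Q _)).
have E := @coprodA _ _ H a; apply: (congr1 p3). refine E.
Qed.

Definition quot_hopf : hopf_algebroid K S :=
  @HopfAlgebroid K S qetaL qetaR qcounit qcoprod qantip
    qcounit_etaL qcounit_etaR qcoprod_etaL qcoprod_etaR qcounitl qcounitr
    qcoprodA qantip_etaL qantip_etaR qantipK qmull qmulr.
End Quotient.
End QuotientHopfAlgebroid.

(* The trivial comodule: the coaction of k = R/m for which 1 is primitive. *)
Section ResidueComodule.
Variables (R G : comNzRingType) (H : hopf_algebroid R G).
Variables (m : maximal_idealr R) (inv : invariant_ideal H m).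
Notation L := (etaL H).
Notation E := (etaR H).
Notation kk := (ralg (to_residue m)).
Notation one_kk := ((1 : residue m) : kk).

Definition residue_coact (x : kk) : cotens L E kk :=
  ctens L E (L (repr (x : residue m))) one_kk.

Let ctens_m r : r \in m -> ctens L E (L r) one_kk = 0.
Proof.
move=> /(etaL_ext H); rewrite (inv (L r)) => /ideal_genP[s sE ->].
have z (a : G) : ctens L E a (0 : kk) = 0.
  by apply: (addIr (ctens L E a (0 : kk))); rewrite -ctensDr !add0r.
have z' : ctens L E 0 one_kk = 0.
  by apply: (addIr (ctens L E 0 one_kk)); rewrite -ctensDl !add0r.
elim: s sE => [|p s IH] sE; first by rewrite big_nil.
rewrite big_cons ctensDl IH ?addr0; last by move=> q qs; apply: sE; rewrite inE qs orbT.
have [t tm <-] := sE p (mem_head _ _).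
have /eqP t0 : to_residue m t == 0 by rewrite to_residue_eq0.
rewrite mulrC ctensZ (_ : t *: one_kk = 0) ?z //.
by apply: etrans (mulr1 (to_residue m t)) _.
Qed.

Lemma residue_coactE r :
  residue_coact (to_residue m r) = ctens L E (L r) one_kk.
Proof.
apply/eqP; rewrite -subr_eq0 /residue_coact.
have -> : ctens L E (L (repr (to_residue m r))) one_kk =
          ctens L E (L (repr (to_residue m r) - r)) one_kk +
          ctens L E (L r) one_kk.
  by rewrite -ctensDl -rmorphD subrK.
rewrite addrK ctens_m // -to_residue_eq0 rmorphB subr_eq0; apply/eqP.
exact: (@reprK _ {ideal_quot m}).
Qed.

Let residue_coact_lin : linear residue_coact.
Proof.
move=> a x y; have [b ->] := to_residueP (x : residue m).
have [c ->] := to_residueP (y : residue m).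
have -> : a *: (to_residue m b : kk) + (to_residue m c : kk) =
          (to_residue m (a * b + c) : kk).
  by rewrite rmorphD rmorphM.
by rewrite !residue_coactE cotensZ -ctensDl rmorphD rmorphM.
Qed.
HB.instance Definition _ :=
  GRing.isLinear.Build R kk (cotens L E kk) *:%R residue_coact residue_coact_lin.

Let counit_bal (M : lmodType R) : cobalanced E (fun a (y : M) => counit H a *: y).
Proof.
split=> [a b x|a x y|r a x]; first by rewrite rmorphD scalerDl.
- by rewrite scalerDr.
- by rewrite rmorphM counit_etaR mulrC scalerA.
Qed.

Let residue_counit (x : kk) : colift (fun a (y : kk) => counit H a *: y)
  (residue_coact x) = x.
Proof.
have [b ->] := to_residueP (x : residue m).
rewrite residue_coactE (colift_ctens _ (counit_bal kk)) counit_etaL.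
by rewrite ralgZE mulr1.
Qed.

Let residue_coactA : coassociative (coprod H) residue_coact.
Proof.
move=> x; have [b ->] := to_residueP (x : residue m); rewrite residue_coactE.
have cb : cobalanced E (fun a (y : kk) => ctens L E a (residue_coact y)).
  by apply: coact_balanced => [y z|r y]; rewrite ?linearD ?linearZ.
rewrite (colift_ctens _ cb).
rewrite (colift_ctens _ (@assoc_balanced _ _ _ _ kk _ (@coprod_etaR _ _ H))).
rewrite coprod_etaL assoc_gtens -(rmorph1 (to_residue m)) residue_coactE rmorph1.
by rewrite rmorph1.
Qed.

Definition residue_comodule : comodule H kk :=
  @Comodule _ _ H kk residue_coact residue_counit residue_coactA.

Lemma residue_comodule_primitive : primitive residue_comodule one_kk.
Proof.
rewrite /primitive /= -{1}(rmorph1 (to_residue m)).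
by apply: etrans (residue_coactE 1) _; rewrite rmorph1.
Qed.
End ResidueComodule.

Section Submodules.
Variables (R : comNzRingType) (M : lmodType R).

Record submod (N : submodClosed M) : Type :=
  Submod { submod_val : M; submod_valP : submod_val \in N }.

Section Submod.
Variable N : submodClosed M.
HB.instance Definition _ := [isSub for @submod_val N].
HB.instance Definition _ := [Choice of submod N by <:].
HB.instance Definition _ := [SubChoice_isSubLmodule of submod N by <:].

Definition submod_incl : submod N -> M := val.
HB.instance Definition _ := GRing.Linear.on submod_incl.

(* A submodClosed predicate is not canonically a zmodClosed one. *)
Definition submod_pred : {pred M} := fun x => x \in N.
HB.instance Definition _ :=
  GRing.isSubmodClosed.Build R M submod_pred (@GRing.subsemimodClosedP R M N).

Definition quotmod : Type := {ideal_quot submod_pred}.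
HB.instance Definition _ := GRing.Zmodule.on quotmod.
Definition quotmod_proj : M -> quotmod := \pi_({ideal_quot submod_pred}).
Definition quotmod_scale (a : R) (x : quotmod) : quotmod :=
  quotmod_proj (a *: repr x).

Lemma quotmod_proj_eq x y : (quotmod_proj x == quotmod_proj y) = (x - y \in N).
Proof. by rewrite -[RHS]/(x - y \in submod_pred) Quotient.idealrBE. Qed.

Let projD x y : quotmod_proj (x + y) = quotmod_proj x + quotmod_proj y.
Proof. exact: (raddfD (\pi_({ideal_quot submod_pred}))). Qed.

Let quotmod_scale_pi a x : quotmod_scale a (quotmod_proj x) = quotmod_proj (a *: x).
Proof.
apply/eqP; rewrite quotmod_proj_eq -scalerBr rpredZ // -quotmod_proj_eq.
by rewrite /quotmod_proj reprK.
Qed.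
Let quotP (P : quotmod -> Prop) : (forall x, P (quotmod_proj x)) -> forall x, P x.
Proof. by move=> h x; rewrite -[x]reprK; apply: h. Qed.

Let quotmod_scaleA a b x :
  quotmod_scale a (quotmod_scale b x) = quotmod_scale (a * b) x.
Proof. by elim/quotP: x => x; rewrite !quotmod_scale_pi scalerA. Qed.
Let quotmod_scale1 : left_id 1 quotmod_scale.
Proof. by elim/quotP => x; rewrite !quotmod_scale_pi scale1r. Qed.
Let quotmod_scaleDr : right_distributive quotmod_scale +%R.
Proof.
move=> a; elim/quotP=> x; elim/quotP=> y.
by rewrite -projD !quotmod_scale_pi scalerDr projD.
Qed.
Let quotmod_scaleDl x : {morph quotmod_scale^~ x : a b / a + b}.
Proof. by elim/quotP: x => x a b; rewrite !quotmod_scale_pi scalerDl projD. Qed.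
HB.instance Definition _ := GRing.Zmodule_isLmodule.Build R quotmod
  quotmod_scaleA quotmod_scale1 quotmod_scaleDr quotmod_scaleDl.

Let quotmod_proj_lin : linear quotmod_proj.
Proof. by move=> a x y; rewrite projD -quotmod_scale_pi. Qed.
HB.instance Definition _ :=
  GRing.isLinear.Build R M quotmod *:%R quotmod_proj quotmod_proj_lin.
End Submod.

(* N, or rather its intersection with N', as a submodule of N'. *)
Definition submod_in (N N' : submodClosed M) : {pred submod N'} :=
  fun x => submod_val x \in N.

Section SubmodIn.
Variables N N' : submodClosed M.
Let submod_in_closed : subsemimod_closed (submod_in N (N' := N')).
Proof.
have E x : (x \in submod_in N (N' := N')) = (submod_incl x \in N) by [].
split; first split; first by rewrite E raddf0 rpred0.
  by move=> x y xN yN; rewrite E raddfD rpredD.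
by move=> a x xN; rewrite E linearZ rpredZ.
Qed.
HB.instance Definition _ := GRing.isSubmodClosed.Build R (submod N')
  (submod_in N (N' := N')) submod_in_closed.
End SubmodIn.
End Submodules.

(* F 0, ..., F l are the members of the filtration.  The coaction of a quotient
   comodule is the one for which the projection is a comodule map.            *)
Definition trivial_filtration (R G : comNzRingType) (H : hopf_algebroid R G)
    (m : maximal_idealr R) (inv : invariant_ideal H m)
    (M : lmodType R) (rho : comodule H M)
    (l : nat) (F : nat -> submodClosed M) : Prop :=
  [/\ forall x, x \in F l, forall x, (x \in F 0) = (x == 0),
      forall k, (k < l)%N -> forall x, x \in F k -> x \in F k.+1
    & exists rhoF : forall k, comodule H (submod (F k)),
      (forall k, (k <= l)%N -> comodule_hom (rhoF k) rho (@submod_incl _ _ (F k)))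
      /\
      (forall k, (k < l)%N ->
         exists2 rhoQ : comodule H (quotmod (submod_in (F k) (N' := F k.+1))),
           comodule_hom (rhoF k.+1) rhoQ (@quotmod_proj _ _ _)
         & comodule_iso rhoQ (residue_comodule inv))].

(* Main.v *)
(* For a stable submodule N (one with rho N inside the image of G (x) N), the
   submodule m N is stable too, because invariance turns the factors of m G into
   factors of G m, which cross the tensor product.  The last non-zero term of
   M, m M, m^2 M, ... is therefore a subcomodule killed by m; it is a finite
   dimensional comodule over (R / m, G / m G), and unipotence provides a primitive
   in it.  Applied to the quotients of M, this adjoins one primitive after another
   to the zero submodule, and the ascending chain so obtained reaches M since M is
   a Noetherian module.                                                       *)
Require Import Defs.
From HB Require Import structures.
From mathcomp Require Import all_boot all_algebra.
From mathcomp Require Import generic_quotient ring_quotient.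
From mathcomp Require Import boolp classical_sets.

Set Implicit Arguments.
Unset Strict Implicit.
Unset Printing Implicit Defensive.

Import GRing.Theory.
Local Open Scope ring_scope.

(** * Spans and submodules of finitely generated modules over a Noetherian ring *)

Section Span.
Variable R : comNzRingType.

Lemma memB (M : lmodType R) (N : submodClosed M) x y :
  x \in N -> y \in N -> x - y \in N.
Proof. by move=> xN yN; rewrite rpredD // -scaleN1r rpredZ. Qed.

(** The means by which m N, N + R x, ideals of coefficients and unions of chains become bundled
    submodules below; membership is decided classically. *)
Lemma submod_of_pred (M : lmodType R) (P : M -> Prop) :
  P 0 -> (forall x y, P x -> P y -> P (x + y)) ->
  (forall a x, P x -> P (a *: x)) ->
  exists N : submodClosed M, forall x, x \in N <-> P x.
Proof.
move=> P0 PD PZ; pose p : {pred M} := fun x => `[< P x >].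
have E x : x \in p <-> P x by split=> [/asboolP|/asboolP].
have pc : GRing.subsemimod_closed p.
  split; first split; first exact/E.
    by move=> x y /E ? /E ?; apply/E/PD.
  by move=> a x /E ?; apply/E/PZ.
by exists (HB.pack_for (submodClosed M) p (GRing.isSubmodClosed.Build R M p pc)).
Qed.

(** Each occurrence in the list carries its own coefficient, unlike in [fin_gen], where the
    coefficient is a function of the generator; this form suits induction on [s]. *)
Fixpoint span (M : lmodType R) (s : seq M) (x : M) : Prop :=
  if s is y :: s' then exists r z, span s' z /\ x = r *: y + z else x = 0.

Section SpanTheory.
Variable M : lmodType R.
Implicit Types (s : seq M) (x y : M).

Lemma span0 s : span s 0.
Proof. by elim: s => //= y s IH; exists 0, 0; rewrite scale0r addr0. Qed.

Lemma spanD s x y : span s x -> span s y -> span s (x + y).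
Proof.
elim: s x y => /= [x y -> ->|w s IH x y]; first by rewrite addr0.
move=> [r [z [sz ->]]] [r' [z' [sz' ->]]]; exists (r + r'), (z + z').
by split; [exact: IH|rewrite scalerDl addrACA].
Qed.

Lemma spanZ s a x : span s x -> span s (a *: x).
Proof.
elim: s x => /= [x ->|w s IH x]; first by rewrite scaler0.
move=> [r [z [sz ->]]]; exists (a * r), (a *: z).
by split; [exact: IH|rewrite scalerDr scalerA].
Qed.

Lemma span_cat s t x y : span s x -> span t y -> span (s ++ t) (x + y).
Proof.
elim: s x => /= [x -> |w s IH x]; first by rewrite add0r.
move=> [r [z [sz ->]]] ty; exists r, (z + y).
by split; [exact: IH|rewrite addrA].
Qed.

Lemma mem_span s y : y \in s -> span s y.
Proof.
elim: s => //= w s IH; rewrite inE => /orP[/eqP ->|/IH sy].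
  by exists 1, 0; rewrite scale1r addr0; split=> //; exact: span0.
by exists 0, y; rewrite scale0r add0r.
Qed.

Lemma span_sub s (N : submodClosed M) x :
  (forall y, y \in s -> y \in N) -> span s x -> x \in N.
Proof.
elim: s x => /= [x _ ->|w s IH x sN]; first exact: rpred0.
move=> [r [z [sz ->]]]; apply: rpredD; first by apply/rpredZ/sN/mem_head.
by apply: IH => // y ys; apply: sN; rewrite inE ys orbT.
Qed.

Lemma fin_genP : fin_gen M <-> exists s : seq M, forall x, span s x.
Proof.
split=> -[s sM].
  exists s => x; have [c ->] := sM x; rewrite big_seq.
  apply: big_ind => [||y ys]; [exact: span0|exact: spanD|].
  exact/spanZ/mem_span.
(* A coefficient function takes equal values at repeated generators. Without repetitions the
   indicator function of y has sum exactly y. *)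
exists (undup s) => x.
have [N NE] := @submod_of_pred M (fun x => exists c : M -> R,
    x = \sum_(y <- undup s) c y *: y)
  (ltac:(by exists (fun=> 0); rewrite big1 // => y _; rewrite scale0r))
  (ltac:(by move=> _ _ [c ->] [d ->]; exists (fun y => c y + d y);
            rewrite -big_split; apply: eq_bigr => y _; rewrite scalerDl))
  (ltac:(by move=> a _ [c ->]; exists (fun y => a * c y);
            rewrite scaler_sumr; apply: eq_bigr => y _; rewrite scalerA)).
apply/NE; apply: span_sub (sM x) => y ys; apply/NE.
exists (fun z => (z == y)%:R).
rewrite (bigD1_seq y) ?mem_undup ?undup_uniq //= eqxx scale1r big1 ?addr0 //.
by move=> z /negPf ->; rewrite scale0r.
Qed.
End SpanTheory.

Lemma span_map (M N : lmodType R) (f : {linear M -> N}) s x :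
  span s x -> span (map f s) (f x).
Proof.
elim: s x => /= [x ->|y s IH x]; first exact: linear0.
move=> [r [z [sz ->]]]; exists r, (f z); split; first exact: IH.
by rewrite linearD linearZ.
Qed.

Lemma span_map_inj (M N : lmodType R) (f : {linear M -> N}) s x :
  injective f -> span (map f s) (f x) -> span s x.
Proof.
move=> fI; elim: s x => /= [x|y s IH x].
  by rewrite -(linear0 f) => /fI.
move=> [r [z [sz e]]]; exists r, (x - r *: y); split; last by rewrite addrC subrK.
by apply: IH; rewrite linearB linearZ e addrC addKr.
Qed.

Lemma fin_gen_surj (M N : lmodType R) (f : {linear M -> N}) :
  (forall y, exists x, f x = y) -> fin_gen M -> fin_gen N.
Proof.
move=> fS /fin_genP[s sM]; apply/fin_genP; exists (map f s) => y.
by have [x <-] := fS y; apply: span_map.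
Qed.

Hypothesis noethR : noetherian R.

(* Hilbert's argument: the coefficients of the first generator y which occur in
   N form an ideal, and its generators lift to N.                             *)
Lemma noetherian_span (M : lmodType R) (s : seq M) (N : submodClosed M) :
  (forall x, x \in N -> span s x) ->
  exists2 t : seq M, (forall y, y \in t -> y \in N)
                   & forall x, x \in N -> span t x.
Proof.
elim: s N => [|y s IH] N sN; first by exists [::].
have [I IE] := @submod_of_pred R^o
  (fun r => exists2 z, span s z & (r : R) *: y + z \in N)
  (ltac:(by exists 0; rewrite ?scale0r ?addr0 ?rpred0 //; exact: span0))
  (ltac:(by move=> r r' [z sz h] [z' sz' h']; exists (z + z');
            [exact: spanD|rewrite scalerDl addrACA rpredD]))
  (ltac:(by move=> a r [z sz h]; exists (a *: z);
            [exact: spanZ|rewrite -scalerA -scalerDr rpredZ])).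
have [g gI] := noethR I.
(* The elements of N that need no y: the induction hypothesis applies to them. *)
have [N' N'E] := @submod_of_pred M (fun x => x \in N /\ span s x)
  (ltac:(by split; [exact: rpred0|exact: span0]))
  (ltac:(by move=> u v [? ?] [? ?]; split; [exact: rpredD|exact: spanD]))
  (ltac:(by move=> a u [? ?]; split; [exact: rpredZ|exact: spanZ])).
have [t' t'N t's] := IH N' (fun x h => proj2 (proj1 (N'E x) h)).
have /choice[z zP] (r : R) : exists z, r \in g -> span s z /\ r *: y + z \in N.
  have [rg|] := boolP (r \in g); last by exists 0.
  have /IE[z sz h] : (r : R^o) \in I.
    by rewrite gI -[r]mul1r; apply: mem_ideal_gen.
  by exists z.
pose n r := r *: y + z r.
exists (map n g ++ t').
  move=> x; rewrite mem_cat => /orP[/mapP[r rg ->]|/t'N /N'E[] //].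
  by have [] := zP r rg.
move=> x xN; have [r [w [sw xE]]] := sN x xN.
have rI : (r : R^o) \in I by apply/IE; exists w; rewrite -?xE.
have /ideal_genP[c cg rE] : r \in ideal_gen [set` g] by rewrite -gI.
pose v := \sum_(p <- c) p.1 *: n p.2.
have vg : span (map n g) v.
  rewrite /v big_seq; apply: big_ind => [||p pc]; [exact: span0|exact: spanD|].
  by apply/spanZ/mem_span/map_f/cg.
have vN : v \in N.
  apply: span_sub vg => _ /mapP[q qg ->]; by have [] := zP q qg.
(* The element v of N has the same coefficient at y as x, so x - v lies in N and in the span of
   [s]. *)
rewrite -(subrK v x) addrC; apply: span_cat vg _; apply/t's/N'E; split.
  exact: memB.
have -> : x - v = w - \sum_(p <- c) p.1 *: z p.2.
  rewrite xE rE scaler_suml /v /n.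
  under [X in _ - X]eq_bigr do rewrite scalerDr scalerA.
  by rewrite big_split opprD addrACA subrr add0r.
apply: spanD => //; rewrite -scaleN1r; apply: spanZ; rewrite big_seq.
apply: big_ind => [||p pc]; [exact: span0|exact: spanD|].
by apply: spanZ; have [] := zP p.2 (cg p pc).
Qed.

Lemma noetherian_fin_gen (M : lmodType R) (N : submodClosed M) : fin_gen M ->
  exists2 t : seq M, (forall y, y \in t -> y \in N)
                   & forall x, x \in N -> span t x.
Proof. by move=> /fin_genP[s sM]; apply: (@noetherian_span _ s). Qed.

(** Generators of N found in M lift to [submod N], and the inclusion, being injective, reflects
    spans. *)
Lemma fin_gen_submod (M : lmodType R) (N : submodClosed M) :
  fin_gen M -> fin_gen (submod N).
Proof.
move=> /(@noetherian_fin_gen _ N)[t tN ts]; apply/fin_genP.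
exists (pmap insub t) => x; apply: (@span_map_inj _ _ (@submod_incl _ _ N)).
  exact: val_inj.
have -> : map (@submod_incl _ _ N) (pmap insub t) = t.
  rewrite (pmap_filter (insubK _)); apply/all_filterP/allP => y /tN yN.
  by rewrite /= insubT.
exact/ts/submod_valP.
Qed.

(** The union of the chain is a finitely generated submodule, and a member that contains its
    finitely many generators is already the union. *)
Lemma noetherian_chain (M : lmodType R) (F : nat -> submodClosed M) :
  fin_gen M -> (forall k x, x \in F k -> x \in F k.+1) ->
  exists k, forall x, x \in F k.+1 -> x \in F k.
Proof.
move=> fgM F1.
have Fle i j x : (i <= j)%N -> x \in F i -> x \in F j.
  move=> /subnK <-; elim: (j - i)%N => // d IH xi; exact/F1/IH.
have [U UE] := @submod_of_pred M (fun x => exists k, x \in F k)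
  (ltac:(by exists 0%N; exact: rpred0))
  (ltac:(by move=> x y [i xi] [j yj]; exists (maxn i j);
       rewrite rpredD // ?(Fle _ _ _ (leq_maxl _ _) xi) ?(Fle _ _ _ (leq_maxr _ _) yj)))
  (ltac:(by move=> a x [i xi]; exists i; exact: rpredZ)).
have [t tU ts] := noetherian_fin_gen U fgM.
suff [k tk] : exists k, forall y, y \in t -> y \in F k.
  exists k => x xk; apply: span_sub tk _; apply/ts/UE; by exists k.+1.
elim: t tU {ts} => [|y t IH] tU; first by exists 0%N.
have /UE[i yi] := tU y (mem_head _ _).
have [|k tk] := IH; first by move=> z zt; apply: tU; rewrite inE zt orbT.
exists (maxn i k) => z; rewrite inE => /orP[/eqP ->|/tk].
  exact: Fle (leq_maxl _ _) yi.
exact: Fle (leq_maxr _ _).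
Qed.
End Span.

(** * Quotient modules *)

Section Quotmod.
Variables (R : comNzRingType) (M : lmodType R) (N : submodClosed M).

Lemma quotmod_projP x : quotmod_proj N x = 0 <-> x \in N.
Proof.
rewrite -(linear0 (quotmod_proj N)); split.
  by move/eqP; rewrite quotmod_proj_eq subr0.
by move=> xN; apply/eqP; rewrite quotmod_proj_eq subr0.
Qed.

Lemma quotmod_surj (q : quotmod N) : exists x, quotmod_proj N x = q.
Proof. by exists (repr q); exact: reprK. Qed.

Lemma quotmod_projB x y : quotmod_proj N x = quotmod_proj N y <-> x - y \in N.
Proof. by split=> [/eqP|h]; [|apply/eqP]; rewrite quotmod_proj_eq. Qed.

End Quotmod.

(** * Functoriality and right exactness of the tensor product with G *)

Section Cmap.
Variables (R G : comNzRingType) (eL eR : {rmorphism R -> G}).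
Notation ct := (ctens eL eR).

Lemma ctens0r (M : lmodType R) a : ct a (0 : M) = 0.
Proof. by apply: (addIr (ct a (0 : M))); rewrite -ctensDr !add0r. Qed.

Lemma ctens0l (M : lmodType R) (x : M) : ct 0 x = 0.
Proof. by apply: (addIr (ct 0 x)); rewrite -ctensDl !add0r. Qed.

Section Map.
Variables (M N : lmodType R) (f : {linear M -> N}).

(** The map id (x) f, spelled as in [comodule_hom], which thus reads [rhoN (f x) = cmap f (rhoM x)]
    up to conversion. *)
Definition cmap : cotens eL eR M -> cotens eL eR N := colift (fun a y => ct a (f y)).

Let bal : cobalanced eR (fun a y => ct a (f y)).
Proof.
split=> [a b x|a x y|r a x]; first exact: ctensDl.
- by rewrite linearD ctensDr.
- by rewrite linearZ ctensZ.
Qed.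

Lemma cmapE a x : cmap (ct a x) = ct a (f x).
Proof. exact: (colift_ctens _ bal). Qed.

Lemma cmapD t u : cmap (t + u) = cmap t + cmap u.
Proof. exact: (coliftD bal). Qed.

Lemma cmap0 : cmap 0 = 0.
Proof. exact: (colift0 _ bal). Qed.

Lemma cmapP : linear cmap.
Proof.
move=> r t u; rewrite cmapD; congr (_ + _); elim/cotens_ind: t => [|a x t IH].
  by rewrite scaler0 [cmap 0](colift0 _ bal) scaler0.
by rewrite scalerDr !cmapD scalerDr IH cotensZ !cmapE cotensZ.
Qed.
Lemma cmapB t u : cmap (t - u) = cmap t - cmap u.
Proof. by rewrite addrC -[- u]scaleN1r cmapP scaleN1r addrC. Qed.

HB.instance Definition _ :=
  GRing.isLinear.Build R (cotens eL eR M) (cotens eL eR N) *:%R cmap cmapP.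

(** Flatness in the form used below: the map in [flat] is [cmap f] by unfolding. *)
Lemma cmap_inj : flat (ralg eR) -> injective f -> injective cmap.
Proof. by move=> fl fI; apply: (fl _ _ f fI). Qed.
End Map.

Lemma eq_cmap (M N : lmodType R) (f g : {linear M -> N}) : f =1 g -> cmap f =1 cmap g.
Proof. by move=> fg; apply: eq_colift => a x; rewrite fg. Qed.

Lemma cmap_comp (M N P : lmodType R) (f : {linear N -> P}) (g : {linear M -> N}) t :
  cmap f (cmap g t) = cmap (f \o g) t.
Proof.
elim/cotens_ind: t => [|a x t IH]; first by rewrite !cmap0.
by rewrite !cmapD IH !cmapE.
Qed.

(* The image in [cotens M] of the tensor product with the submodule N. *)
Inductive tens_in (M : lmodType R) (N : {pred M}) : cotens eL eR M -> Prop :=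
| tens_in0 : tens_in N 0
| tens_inS a x t : x \in N -> tens_in N t -> tens_in N (ct a x + t).

Section TensIn.
Variable M : lmodType R.
Implicit Types (N : submodClosed M) (t u : cotens eL eR M).

Lemma tens_in_ctens (N : {pred M}) a x : x \in N -> tens_in N (ct a x).
Proof. by move=> xN; rewrite -[ct a x]addr0; do 2?constructor. Qed.

Lemma tens_inD (N : {pred M}) t u : tens_in N t -> tens_in N u -> tens_in N (t + u).
Proof.
by elim=> [|a x v xN _ IH] uN; rewrite ?add0r // -addrA; constructor => //; exact: IH.
Qed.

Lemma tens_in_lact (N : {pred M}) a t : tens_in N t -> tens_in N (lact a t).
Proof.
elim=> [|b x v xN _ IH]; first by rewrite lact0r; constructor.
by rewrite lactDr lact_ctens; constructor.
Qed.

Lemma tens_inW (N N' : {pred M}) t :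
  (forall x, x \in N -> x \in N') -> tens_in N t -> tens_in N' t.
Proof. by move=> NN'; elim=> [|a x v /NN' xN _ IH]; constructor. Qed.

Lemma tens_in_lift N t :
  tens_in N t -> exists u : cotens eL eR (submod N), cmap (@submod_incl _ _ N) u = t.
Proof.
elim=> [|a x v xN _ [u <-]]; first by exists 0; rewrite cmap0.
by exists (ct a (Submod xN) + u); rewrite cmapD cmapE.
Qed.

Lemma tens_in_cmap_ker (Q : lmodType R) (f : {linear M -> Q}) (N : {pred M}) t :
  (forall x, x \in N -> f x = 0) -> tens_in N t -> cmap f t = 0.
Proof.
move=> fN; elim=> [|a x v xN _ IH]; first exact: cmap0.
by rewrite cmapD cmapE fN // ctens0r IH addr0.
Qed.

(* Right exactness: modulo the image of the tensor product with N, the pure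
   tensor [a (x) x] depends on the class of x modulo N only.                   *)
Lemma cmap_quotmod_ker N t : cmap (quotmod_proj N) t = 0 -> tens_in N t.
Proof.
have [I IE] := @submod_of_pred R (cotens eL eR M) (tens_in N)
  (tens_in0 _) (@tens_inD N) (fun r t => @tens_in_lact N (eL r) t).
(* Sends a (x) [y] to the class of a (x) y modulo [I]. Composed with [cmap (quotmod_proj N)] it is
   the projection modulo [I], so the kernel of the former lies in [I]. *)
pose h a (q : quotmod N) := quotmod_proj I (ct a (repr q)).
have hE a x : h a (quotmod_proj N x) = quotmod_proj I (ct a x).
  rewrite /h; apply/quotmod_projB/IE; set y := repr _.
  have -> : ct a y - ct a x = ct a (y - x).
    by apply: (addIr (ct a x)); rewrite subrK -ctensDr subrK.
  by apply/tens_in_ctens/quotmod_projB; exact: reprK.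
have hb : cobalanced eR h.
  split=> [a b q|a q q'|r a q].
  - by have [x <-] := quotmod_surj q; rewrite !hE ctensDl linearD.
  - have [x <-] := quotmod_surj q; have [x' <-] := quotmod_surj q'.
    by rewrite -linearD !hE ctensDr linearD.
  - by have [x <-] := quotmod_surj q; rewrite -linearZ !hE ctensZ.
move=> /(congr1 (colift h)); rewrite (colift0 _ hb).
suff -> : colift h (cmap (quotmod_proj N) t) = quotmod_proj I t.
  by move=> /quotmod_projP /IE.
elim/cotens_ind: t => [|a x t IH]; first by rewrite cmap0 (colift0 _ hb) linear0.
by rewrite cmapD (coliftD hb) IH cmapE (colift_ctens _ hb) hE linearD.
Qed.
End TensIn.
End Cmap.

(** * Subcomodules and quotient comodules *)

Section ComoduleTheory.
Variables (R G : comNzRingType) (H : hopf_algebroid R G).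
Notation L := (etaL H).
Notation E := (etaR H).
Notation ct := (ctens L E).
Notation cm := (@cmap R G L E _ _).

(** The map psi (x) id followed by reassociation; coassociativity becomes
    [cassoc (rho x) = cmap rho (rho x)]. *)
Definition cassoc (M : lmodType R) : cotens L E M -> cotens L E (cotens L E M) :=
  colift (fun a y => assoc_tens (coprod H a) y).

Lemma cassocE (M : lmodType R) a (x : M) : cassoc (ct a x) = assoc_tens (coprod H a) x.
Proof. exact: (colift_ctens _ (@assoc_balanced _ _ _ _ M _ (@coprod_etaR _ _ H))). Qed.

Lemma cassocD (M : lmodType R) (t u : cotens L E M) :
  cassoc (t + u) = cassoc t + cassoc u.
Proof. exact: (coliftD (@assoc_balanced _ _ _ _ M _ (@coprod_etaR _ _ H))). Qed.

Lemma cassoc0 (M : lmodType R) : cassoc (0 : cotens L E M) = 0.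
Proof. exact: (colift0 _ (@assoc_balanced _ _ _ _ M _ (@coprod_etaR _ _ H))). Qed.

Lemma cassoc_cmap (M N : lmodType R) (f : {linear M -> N}) t :
  cassoc (cm f t) = cm (cm f) (cassoc t).
Proof.
elim/cotens_ind: t => [|a x t IH]; first by rewrite cmap0 !cassoc0 cmap0.
rewrite cmapD !cassocD cmapD IH cmapE !cassocE; congr (_ + _).
move: (coprod H a) => u; elim/gamma2_ind: u => [|b c u IHu].
  by rewrite !assoc_tens0l cmap0.
by rewrite !assoc_tensDl cmapD IHu !assoc_gtens cmapE /= cmapE.
Qed.

Lemma coact_cassoc (M : lmodType R) (rho : comodule H M) x :
  cassoc (rho x) = cm rho (rho x).
Proof. by symmetry; exact: coactA. Qed.

Definition ccounit (M : lmodType R) : cotens L E M -> M :=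
  colift (fun a y => counit H a *: y).

Lemma ccounit_balanced (M : lmodType R) :
  cobalanced E (fun a (y : M) => counit H a *: y).
Proof.
split=> [a b x|a x y|r a x]; first by rewrite rmorphD scalerDl.
- by rewrite scalerDr.
- by rewrite rmorphM counit_etaR mulrC scalerA.
Qed.

Lemma ccounit_cmap (M N : lmodType R) (f : {linear M -> N}) t :
  ccounit (cm f t) = f (ccounit t).
Proof.
have b := ccounit_balanced; rewrite /ccounit.
elim/cotens_ind: t => [|a x t IH].
  by rewrite cmap0 !(colift0 _ (b _)) linear0.
by rewrite cmapD !(coliftD (b _)) linearD IH cmapE !(colift_ctens _ (b _)) linearZ.
Qed.

(** Flatness makes [cmap f] and [cmap (cmap f)] injective. Linearity, counit and coassociativity of
    the lifted coaction are then checked after applying [cmap f], [f] and [cmap (cmap f)], where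
    they hold for [rho]. *)
Lemma sub_comodule (N M : lmodType R) (f : {linear N -> M}) (rho : comodule H M) :
  flat (ralg E) -> injective f -> (forall x, exists u, cm f u = rho (f x)) ->
  exists rhoN : comodule H N, comodule_hom rhoN rho f.
Proof.
move=> fl fI /choice[r rE].
have cI := cmap_inj (eL := L) fl fI.
have rlin : linear r.
  by move=> a x y; apply: cI; rewrite cmapP !rE !linearP.
pose r' : {linear N -> cotens L E N} :=
  HB.pack_for {linear N -> cotens L E N} r
    (GRing.isLinear.Build R N (cotens L E N) *:%R r rlin).
have rc x : ccounit (r' x) = x.
  by apply: fI; rewrite -ccounit_cmap rE; exact: coact_counit.
have ra : coassociative (coprod H) r'.
  move=> x; apply: (cmap_inj (eL := L) fl cI); rewrite -/(cassoc _) -cassoc_cmap rE.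
  rewrite coact_cassoc.
  have -> : rho (f x) = cm f (r' x) by rewrite rE.
  by rewrite !cmap_comp; apply: eq_cmap => y /=; rewrite rE.
by exists (Comodule rc ra) => x; rewrite /= -[RHS]/(cm f (r x)) rE.
Qed.

(** The coaction is computed on preimages under a chosen section [s]; the condition on the kernel of
    g makes it independent of [s], and the axioms descend along the surjection. *)
Lemma quot_comodule (M Q : lmodType R) (g : {linear M -> Q}) (rho : comodule H M) :
  (forall q, exists x, g x = q) -> (forall x, g x = 0 -> cm g (rho x) = 0) ->
  exists rhoQ : comodule H Q, comodule_hom rho rhoQ g.
Proof.
move=> /choice[s sK] g0.
pose r q := cm g (rho (s q)).
have rE x : r (g x) = cm g (rho x).
  apply/eqP; rewrite -subr_eq0 -cmapB -linearB; apply/eqP/g0.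
  by rewrite linearB sK subrr.
have rlin : linear r.
  by move=> a x y; rewrite -[x]sK -[y]sK -linearP !rE linearP cmapP.
pose r' : {linear Q -> cotens L E Q} :=
  HB.pack_for {linear Q -> cotens L E Q} r
    (GRing.isLinear.Build R Q (cotens L E Q) *:%R r rlin).
have rc x : ccounit (r' x) = x.
  by rewrite -[x]sK /= rE ccounit_cmap [ccounit _]coact_counit.
have ra : coassociative (coprod H) r'.
  move=> x; rewrite -[x]sK /= rE -/(cassoc _) cassoc_cmap.
  rewrite coact_cassoc -/(cm r' _).
  by rewrite !cmap_comp; apply: eq_cmap => y /=; rewrite rE.
by exists (Comodule rc ra) => x; rewrite /= rE.
Qed.

(** A condition inside M, easier to propagate than a coaction on N; flatness turns it into one in
    [stable_sub_comodule]. *)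
Definition stable (M : lmodType R) (rho : comodule H M) (N : {pred M}) : Prop :=
  forall x, x \in N -> tens_in N (rho x).

Lemma stable_sub_comodule (M : lmodType R) (rho : comodule H M) (N : submodClosed M) :
  flat (ralg E) -> stable rho N ->
  exists rhoN : comodule H (submod N), comodule_hom rhoN rho (@submod_incl _ _ N).
Proof.
move=> fl Ns; apply: sub_comodule => //; first exact: val_inj.
by move=> x; apply/tens_in_lift/Ns/submod_valP.
Qed.

Lemma stable_quot_comodule (M : lmodType R) (rho : comodule H M) (N : submodClosed M) :
  stable rho N ->
  exists rhoQ : comodule H (quotmod N), comodule_hom rho rhoQ (@quotmod_proj _ _ N).
Proof.
move=> Ns; apply: quot_comodule => [q|x /quotmod_projP xN]; first exact: quotmod_surj.
by apply: tens_in_cmap_ker (Ns x xN) => y /quotmod_projP.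
Qed.
End ComoduleTheory.

(** * Submodules killed by m, reduction to the residue field, and primitive elements *)

Section Residual.
Variables (R G : comNzRingType) (H : hopf_algebroid R G).
Variables (m : maximal_idealr R) (inv : invariant_ideal H m).
Notation L := (etaL H).
Notation E := (etaR H).
Notation ct := (ctens L E).
Notation K := (residue m).
Notation S := (quot_gamma H m).
Notation qL := (qetaL H m).
Notation qE := (qetaR inv).
Notation qct := (ctens qL qE).
Notation p1 := (to_quot_gamma H m).

Let p1M a b : p1 (a * b) = p1 a * p1 b. Proof. exact: rmorphM. Qed.
Let p1D a b : p1 (a + b) = p1 a + p1 b. Proof. exact: rmorphD. Qed.
Let p1_1 : p1 1 = 1. Proof. exact: rmorph1. Qed.

(* Invariance moves a factor from [m G] across the tensor product. *)
Lemma tens_in_extL (M : lmodType R) (N N' : {pred M}) g t :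
  (forall a x, a \in m -> x \in N -> a *: x \in N') ->
  g \in extL H m -> tens_in N t -> tens_in N' (lact g t : cotens L E M).
Proof.
move=> NN' gm; elim=> [|b x v xN _ IH]; first by rewrite lact0r; constructor.
rewrite lactDr; apply: tens_inD IH; rewrite lact_ctens.
move: gm; rewrite (inv g) => /ideal_genP[s sE ->].
elim: s sE => [|p s IHs] sE; first by rewrite big_nil mul0r ctens0l; constructor.
have [r rm rE] := sE p (mem_head _ _).
rewrite big_cons mulrDl ctensDl; apply: tens_inD; last first.
  by apply: IHs => q qs; apply: sE; rewrite inE qs orbT.
rewrite -rE mulrAC mulrC ctensZ; exact/tens_in_ctens/NN'.
Qed.

Lemma unit_mod_m a : a \notin m -> exists b, b * a - 1 \in m.
Proof.
rewrite -to_residue_eq0 => /residue_unit[y]; have [b ->] := to_residueP y.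
move=> e; exists b; rewrite -to_residue_eq0 rmorphB rmorphM e subr_eq0.
exact/eqP/esym/rmorph1.
Qed.

(** The product m N, with its sums built term by term for induction. *)
Inductive mprod (M : lmodType R) (N : {pred M}) : M -> Prop :=
| mprod0 : mprod N 0
| mprodS a x y : a \in m -> x \in N -> mprod N y -> mprod N (a *: x + y).

Lemma mprod_submod (M : lmodType R) (N : submodClosed M) :
  exists N' : submodClosed M, forall x, x \in N' <-> mprod N x.
Proof.
apply: submod_of_pred => [|x y|b x]; first exact: mprod0.
- elim=> [|a z w am zN _ IH] hy; first by rewrite add0r.
  by rewrite -addrA; constructor => //; apply: IH.
- elim=> [|a z w am zN _ IH]; first by rewrite scaler0; constructor.
  by rewrite scalerDr scalerA mulrC -scalerA; constructor; rewrite ?rpredZ.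
Qed.

(* If m^k kills N, the last non-zero one among N, m N, m^2 N, ... is killed by m. *)
Lemma stable_killed (M : lmodType R) (rho : comodule H M) k (N : submodClosed M) :
  stable rho N -> (exists2 x, x \in N & x != 0) ->
  (forall a x, a \in ideal_exp m k -> x \in N -> a *: x = 0) ->
  exists N' : submodClosed M, [/\ stable rho N', exists2 x, x \in N' & x != 0
    & forall a x, a \in m -> x \in N' -> a *: x = 0].
Proof.
elim: k N => [|k IH] N Ns [x xN x0] kN.
  (* The zeroth power of m is R, so here 1 kills the non-zero x. *)
  by case/eqP: x0; rewrite -(kN 1 x) ?scale1r.
have [N' N'E] := mprod_submod N.
(* If m N is non-zero the descent continues with m N; otherwise N itself is killed by m. *)
have [[a [y [am yN ay0]]]|h] :=
  pselect (exists a y, [/\ a \in m, y \in N & a *: y != 0]); last first.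
  exists N; split=> //; first by exists x.
  by move=> a y am yN; apply/eqP/negP => /negP ay; apply: h; exists a, y.
have mN' b z : b \in m -> z \in N -> b *: z \in N'.
  by move=> bm zN; apply/N'E; rewrite -[_ *: _]addr0; do 2?constructor.
apply: (IH N').
(* By linearity rho (b u) is [etaL b] acting on rho u, and [etaL b] lies in m G; hence it is in the
   image of G (x) m N. *)
- move=> z /N'E; elim=> [|b u v bm uN _ IHv]; first by rewrite linear0; constructor.
  rewrite linearD linearZ; apply: tens_inD IHv.
  exact: (tens_in_extL mN' (etaL_ext H bm) (Ns u uN)).
- by exists (a *: y); rewrite ?mN'.
- move=> b z bk /N'E; elim=> [|c u v cm uN _ IHv]; first by rewrite scaler0.
  rewrite scalerDr IHv addr0 scalerA kN //.
  rewrite mulrC -[c * b]mul1r; apply: mem_ideal_gen; by exists c, b.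
Qed.

Lemma ideal_expM (I : {pred R}) k a b : b \in ideal_exp I k -> a * b \in ideal_exp I k.
Proof.
case: k => // k bk; rewrite -[a * b]addr0; apply: ideal_gen_lin bk _.
exact: ideal_gen0.
Qed.

(** One step at a time: each generator of a power has a factor in the preceding power, which absorbs
    multiplication. *)
Lemma ideal_expW (I : {pred R}) j k a : (j <= k)%N ->
  a \in ideal_exp I k -> a \in ideal_exp I j.
Proof.
move=> /subnK <-; elim: (k - j)%N => // d IH; rewrite addSn => ad; apply: IH.
case/ideal_genP: ad => s sE ->; elim: s sE => [|p s IHs] sE.
  by rewrite big_nil; case: (d + j)%N => // n; exact: ideal_gen0.
have [x [y [_ yk pE]]] := sE p (mem_head _ _).
have pI : p.1 * p.2 \in ideal_exp I (d + j).
  by rewrite pE; do 2!apply: ideal_expM.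
have sI : \sum_(q <- s) q.1 * q.2 \in ideal_exp I (d + j).
  by apply: IHs => q qs; apply: sE; rewrite inE qs orbT.
rewrite big_cons; case: (d + j)%N pI sI => // n pI sI.
by rewrite -[p.1 * p.2]mul1r; apply: ideal_gen_lin.
Qed.

(** The largest of the exponents of the finitely many generators serves for all of M. *)
Lemma discrete_fin_gen (M : lmodType R) : fin_gen M -> discrete m M ->
  exists k, forall a (x : M), a \in ideal_exp m k -> a *: x = 0.
Proof.
move=> /fin_genP[s sM] disc.
have [k kP] : exists k, forall a x, a \in ideal_exp m k -> x \in s -> a *: x = 0.
  elim: s {sM} => [|y s [k kP]]; first by exists 0%N.
  have [j _ jP] := disc y; exists (maxn j k) => a x am.
  rewrite inE => /orP[/eqP ->|]; first exact/jP/(ideal_expW (leq_maxl _ _) am).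
  exact/kP/(ideal_expW (leq_maxr _ _) am).
exists k => a x am; move: (sM x) kP => {sM}; elim: s x => [|y s IH] x /=.
  by move=> -> _; rewrite scaler0.
move=> [r [z [sz ->]]] kP; rewrite scalerDr scalerA mulrC -scalerA.
rewrite (kP a y) ?mem_head // scaler0 add0r IH // => b u bm us.
by apply: kP; rewrite // inE us orbT.
Qed.

(** V under another name, indexed by the proof that m kills it, so that it can carry a vector space
    structure over R / m. *)
Definition resmod (V : lmodType R)
  (mV : forall a (x : V), a \in m -> a *: x = 0) : Type := V.

Section Resmod.
Variables (V : lmodType R) (mV : forall a (x : V), a \in m -> a *: x = 0).
HB.instance Definition _ := GRing.Zmodule.on (resmod mV).
Notation W := (resmod mV).

Definition resmod_scale (a : K) (x : W) : W := repr a *: (x : V).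

Lemma scale_eqm a b (x : V) : a - b \in m -> a *: x = b *: x.
Proof. by move=> abm; apply/eqP; rewrite -subr_eq0 -scalerBl mV. Qed.

Lemma resmod_scaleE a x : resmod_scale (to_residue m a) x = a *: (x : V).
Proof.
apply: scale_eqm; rewrite -to_residue_eq0 rmorphB subr_eq0; apply/eqP.
exact: (@reprK _ {ideal_quot m}).
Qed.

Let scaleA a b x : resmod_scale a (resmod_scale b x) = resmod_scale (a * b) x.
Proof.
have [c ->] := to_residueP a; have [d ->] := to_residueP b.
by rewrite -rmorphM !resmod_scaleE scalerA.
Qed.
Let scale1 : left_id 1 resmod_scale.
Proof. by move=> x; rewrite -(rmorph1 (to_residue m)) resmod_scaleE scale1r. Qed.
Let scaleDr : right_distributive resmod_scale +%R.
Proof. by move=> a x y; rewrite /resmod_scale scalerDr. Qed.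
Let scaleDl x : {morph resmod_scale^~ x : a b / a + b}.
Proof.
move=> a b; have [c ->] := to_residueP a; have [d ->] := to_residueP b.
by rewrite -rmorphD !resmod_scaleE scalerDl.
Qed.
HB.instance Definition _ := GRing.Zmodule_isLmodule.Build K W
  scaleA scale1 scaleDr scaleDl.

Lemma resmodZ a (x : W) : to_residue m a *: x = (a *: (x : V) : W).
Proof. exact: resmod_scaleE. Qed.

Lemma fin_gen_resmod : fin_gen V -> fin_gen W.
Proof.
move=> /fin_genP[s sV]; apply/fin_genP; exists s => x.
move: (sV x) => {sV}; elim: s x => //= y s IH x [r [z [/IH sz ->]]].
by exists (to_residue m r), z; rewrite resmodZ.
Qed.
End Resmod.

Section Red.
Variables (V : lmodType R) (mV : forall a (x : V), a \in m -> a *: x = 0).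
Notation W := (resmod mV).

(* Reduction to the residue field, which is bijective since [m V = 0]. *)
Definition red : cotens L E V -> cotens qL qE W :=
  colift (fun a (y : V) => qct (p1 a) (y : W)).

Let red_bal : cobalanced E (fun a (y : V) => qct (p1 a) (y : W)).
Proof.
split=> [a b x|a x y|r a x]; first by rewrite p1D ctensDl.
- exact: ctensDr.
- by rewrite p1M -(qetaRE inv) ctensZ resmodZ.
Qed.

Lemma redE a x : red (ct a x) = qct (p1 a) (x : W).
Proof. exact: (colift_ctens _ red_bal). Qed.
Lemma redD t u : red (t + u) = red t + red u.
Proof. exact: (coliftD red_bal). Qed.
Lemma red0 : red 0 = 0.
Proof. exact: (colift0 _ red_bal). Qed.
Lemma redZ r t : red (r *: t) = to_residue m r *: red t.
Proof.
elim/cotens_ind: t => [|a x t IH]; first by rewrite scaler0 red0 scaler0.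
rewrite scalerDr !redD IH scalerDr; congr (_ + _).
by rewrite cotensZ !redE p1M cotensZ qetaLE.
Qed.

(** The inverse of [red], on representatives in G; [unredE] shows that their choice does not
    matter. *)
Let unred : cotens qL qE W -> cotens L E V :=
  colift (fun (a : S) (y : W) => ct (repr a) (y : V)).

Lemma ctens_extL a b (x : V) : a - b \in extL H m -> ct a x = ct b x.
Proof.
move=> abm; apply/eqP; rewrite -subr_eq0.
have -> : ct a x - ct b x = ct (a - b) x.
  by apply: (addIr (ct b x)); rewrite subrK -ctensDl subrK.
rewrite -[a - b]mulr1 -lact_ctens; apply/eqP.
(* Since a - b lies in m G = G m, its factors from m cross over to V, which they kill. *)
have : tens_in (pred1 0) (lact (a - b) (ct 1 x)).
  apply: (@tens_in_extL _ predT _ _ _ _ abm) => [c y cm _|]; last exact: tens_in_ctens.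
  by rewrite inE mV.
elim=> // c y t /eqP -> _ ->; by rewrite ctens0r addr0.
Qed.

Let unredE a (x : V) : ct (repr (p1 a)) x = ct a x.
Proof.
apply: ctens_extL; rewrite Quotient.idealrBE.
exact/eqP/(@reprK _ {ideal_quot (extL H m)}).
Qed.

Let unred_bal : cobalanced qE (fun (a : S) (y : W) => ct (repr a) (y : V)).
Proof.
split=> [a b x|a x y|r a x].
- have [c ->] := to_quot_gammaP a; have [d ->] := to_quot_gammaP b.
  by rewrite -p1D !unredE ctensDl.
- exact: ctensDr.
- have [c ->] := to_quot_gammaP a; have [s ->] := to_residueP r.
  by rewrite qetaRE -p1M !unredE ctensZ resmodZ.
Qed.

Lemma red_inj : injective red.
Proof.
apply: (can_inj (g := unred)) => t; rewrite /unred.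
elim/cotens_ind: t => [|a x t IH]; first by rewrite red0 (colift0 _ unred_bal).
by rewrite redD (coliftD unred_bal) IH redE (colift_ctens _ unred_bal) unredE.
Qed.

(** The analogue of [red] on twofold tensor products with G, where both sides of coassociativity
    live. *)
Definition red2 : cotens L E (cotens L E V) -> cotens qL qE (cotens qL qE W) :=
  colift (fun a u => qct (p1 a) (red u)).

Let red2_bal : cobalanced E (fun a u => qct (p1 a) (red u)).
Proof.
split=> [a b x|a x y|r a x]; first by rewrite p1D ctensDl.
- by rewrite redD ctensDr.
- by rewrite p1M -(qetaRE inv) ctensZ redZ.
Qed.

Lemma red2E a u : red2 (ct a u) = qct (p1 a) (red u).
Proof. exact: (colift_ctens _ red2_bal). Qed.
Lemma red2D t u : red2 (t + u) = red2 t + red2 u.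
Proof. exact: (coliftD red2_bal). Qed.
Lemma red2_0 : red2 0 = 0.
Proof. exact: (colift0 _ red2_bal). Qed.

Lemma cassoc_red t : @cassoc _ _ (quot_hopf inv) W (red t) = red2 (cassoc t).
Proof.
elim/cotens_ind: t => [|a x t IH]; first by rewrite red0 !cassoc0 red2_0.
rewrite redD !cassocD red2D IH redE !cassocE; congr (_ + _).
rewrite [coprod _ _](qcoprodE inv); move: (coprod H a) => u.
have p2D t' u' : to_quot_gamma2 inv (t' + u') =
    to_quot_gamma2 inv t' + to_quot_gamma2 inv u'.
  exact: rmorphD.
elim/gamma2_ind: u => [|b c u IHu].
  by rewrite [to_quot_gamma2 inv 0]rmorph0 !assoc_tens0l red2_0.
rewrite p2D !assoc_tensDl red2D IHu to_quot_gamma2E; congr (_ + _).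
by rewrite !assoc_gtens red2E redE.
Qed.

(** Reduction commutes with the counits and with [cassoc], which carries both comodule axioms
    over. *)
Lemma red_comodule (rho : comodule H V) :
  exists rhoW : comodule (quot_hopf inv) W, forall x, rhoW x = red (rho x).
Proof.
pose r (x : W) := red (rho x).
have rlin : linear r.
  move=> a x y; have [b ->] := to_residueP a.
  by rewrite resmodZ /r linearP redD redZ.
pose r' : {linear W -> cotens qL qE W} :=
  HB.pack_for {linear W -> cotens qL qE W} r
    (GRing.isLinear.Build K W (cotens qL qE W) *:%R r rlin).
have rc x : @ccounit _ _ (quot_hopf inv) W (r' x) = x.
  have b' := @ccounit_balanced _ _ (quot_hopf inv) W; have b := ccounit_balanced H V.
  rewrite -[RHS](coact_counit rho x) /= /r /ccounit.
  move: (rho x) => t; elim/cotens_ind: t => [|a y t IH].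
    by rewrite red0 (colift0 _ b) (colift0 _ b').
  rewrite redD (coliftD b) (coliftD b') IH redE (colift_ctens _ b) (colift_ctens _ b').
  by rewrite [counit _ _](qcounitE H m) resmodZ.
have ra : coassociative (coprod (quot_hopf inv)) r'.
  move=> x; apply: etrans (esym (cassoc_red (rho x))); rewrite coact_cassoc /= /r.
  move: (rho x) => t; rewrite -/(cmap r' _); elim/cotens_ind: t => [|a y t IH].
    by rewrite red0 !cmap0 red2_0.
  by rewrite redD !cmapD red2D IH redE !cmapE red2E.
by exists (Comodule rc ra).
Qed.
End Red.

Hypotheses (noethR : noetherian R) (flatG : flat (ralg E)).
Hypothesis unip : unipotent (quot_hopf inv).

Lemma exists_primitive (M : lmodType R) (rho : comodule H M) :
  (exists x : M, x != 0) -> fin_gen M -> discrete m M ->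
  exists x : M, [/\ x != 0, primitive rho x & forall a, a \in m -> a *: x = 0].
Proof.
move=> [x0 x0n] fgM discM; have [k kM] := discrete_fin_gen fgM discM.
(* The whole of M as a submodule, from which the descent through powers of m starts. *)
have [T TE] := @submod_of_pred R M (fun=> True) I (fun _ _ _ _ => I) (fun _ _ _ => I).
have Ts : stable rho T.
  move=> x _; move: (rho x) => t; elim/cotens_ind: t => [|a y t IH]; constructor => //.
  exact/TE.
have [|a x ak _|N [Ns [x1 x1N x1n] mN]] := stable_killed Ts _ (k := k).
- by exists x0 => //; exact/TE.
- exact: kM.
have [rhoN rhoNE] := stable_sub_comodule flatG Ns.
have mV a (x : submod N) : a \in m -> a *: x = 0.
  by move=> am; apply: val_inj; apply: mN am (submod_valP x).
have [rhoW rhoWE] := red_comodule mV rhoN.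
have [||x xn xp] := unip rhoW.
- exact/fin_gen_resmod/fin_gen_submod.
- exists (Submod x1N); apply: contra x1n => /eqP/(congr1 (@submod_incl _ _ N)) e.
  by apply/eqP; apply: etrans e (linear0 _).
exists (submod_incl (x : submod N)); split.
- by apply: contra xn => /eqP e; apply/eqP/val_inj.
- rewrite /primitive rhoNE.
  (* Injectivity of [red] lifts primitivity from G / m G back to G. *)
  suff -> : rhoN x = ct 1 (x : submod N) by exact: cmapE.
  apply: (@red_inj _ mV); rewrite -rhoWE redE p1_1; exact: xp.
- by move=> a am; apply: mN am (submod_valP _).
Qed.
End Residual.

(** * Construction of the filtration *)

Section Filtration.
Variables (R G : comNzRingType) (H : hopf_algebroid R G).
Variables (m : maximal_idealr R) (inv : invariant_ideal H m).
Notation L := (etaL H).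
Notation E := (etaR H).
Notation ct := (ctens L E).
Notation kk := (ralg (to_residue m)).
Notation one_kk := ((1 : residue m) : kk).

(** The annihilator of q is exactly m, so r q corresponds to the class of r. Both coactions are
    determined by linearity from a primitive generator, hence agree. *)
Lemma cyclic_comodule_iso (Q : lmodType R) (rho : comodule H Q) (q : Q) :
  q != 0 -> (forall a, a \in m -> a *: q = 0) -> primitive rho q ->
  (forall z, exists r, z = r *: q) -> comodule_iso rho (residue_comodule inv).
Proof.
move=> q0 mq qp /choice[c cE].
pose g z : kk := to_residue m (c z).
have gE r : g (r *: q) = to_residue m r.
  apply/eqP; rewrite -subr_eq0 -rmorphB to_residue_eq0.
  (* If d q = 0 with d outside m, an inverse b of d modulo m gives q = b d q = 0. *)
  apply: contraT => /unit_mod_m[b bm]; case/eqP: q0.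
  set d := c _ - r in bm *; have dq : d *: q = 0 by rewrite scalerBl -cE subrr.
  have := mq _ bm; rewrite scalerBl -scalerA dq scaler0 scale1r sub0r.
  by move/eqP; rewrite oppr_eq0 => /eqP.
have glin : linear g.
  move=> a x y; rewrite (cE x) (cE y) scalerA -scalerDl !gE.
  by rewrite rmorphD rmorphM.
pose g' : {linear Q -> kk} :=
  HB.pack_for {linear Q -> kk} g (GRing.isLinear.Build R Q kk *:%R g glin).
exists g'.
  exists (fun y : kk => repr (y : residue m) *: q) => [z|y] /=.
    rewrite {2}(cE z); apply/eqP; rewrite -subr_eq0 -scalerBl mq //.
    rewrite -to_residue_eq0 rmorphB subr_eq0; apply/eqP.
    exact: (@reprK _ {ideal_quot m}).
  by rewrite gE; exact: (@reprK _ {ideal_quot m}).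
have g1 : g q = one_kk by rewrite -[q]scale1r gE; exact: rmorph1.
move=> z; have [r ->] : exists r, z = r *: q by exists (c z).
have -> : rho (r *: q) = ct (L r) q by rewrite linearZ /= qp cotensZ mulr1.
rewrite -/(cmap g' _) cmapE /= g1 gE; exact: residue_coactE.
Qed.

Variables (M : lmodType R) (rho : comodule H M).

(* The last clause says that the class of x modulo N is primitive: see
   cmap_quotmod_ker.                                                          *)
Definition trivial_step (N N' : submodClosed M) : Prop :=
  exists x, [/\ x \in N' /\ x \notin N, forall y, y \in N -> y \in N',
    forall y, y \in N' -> exists r, y - r *: x \in N,
    forall a, a \in m -> a *: x \in N & tens_in N (rho x - ct 1 x)].

(** An element of N' is r x plus an element of N, and rho x is 1 (x) x up to the image of G (x)
    N. *)
Lemma trivial_step_stable (N N' : submodClosed M) :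
  stable rho N -> trivial_step N N' -> stable rho N'.
Proof.
move=> Ns [x [[xN' _] NN' gen _ xp]] y yN'.
have [r yr] := gen y yN'.
have -> : rho y = rho (y - r *: x) + r *: (ct 1 x + (rho x - ct 1 x)).
  by rewrite [ct 1 x + _]addrC subrK -linearZ -linearD subrK.
apply: tens_inD; first exact: tens_inW NN' (Ns _ yr).
apply: tens_in_lact; apply: tens_inD; first exact: tens_in_ctens.
exact: tens_inW NN' xp.
Qed.

(** The class of x generates N' / N and is non-zero, primitive and killed by m, as
    [cyclic_comodule_iso] requires. *)
Lemma trivial_step_iso (N N' : submodClosed M) (rhoN' : comodule H (submod N')) :
  flat (ralg E) -> stable rho N -> trivial_step N N' ->
  comodule_hom rhoN' rho (@submod_incl _ _ N') ->
  exists2 rhoQ : comodule H (quotmod (submod_in N (N' := N'))),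
    comodule_hom rhoN' rhoQ (@quotmod_proj _ _ _)
    & comodule_iso rhoQ (residue_comodule inv).
Proof.
move=> fl Ns [x [[xN' xN] NN' gen mx xp]] rhoN'E.
pose D : submodClosed (submod N') := submod_in N (N' := N').
have inclI : injective (cmap (eL := L) (eR := E) (@submod_incl _ _ N')).
  by apply: cmap_inj => //; exact: val_inj.
(* By flatness G (x) N' embeds in G (x) M, so an element that lands in the image of G (x) N already
   comes from N inside N'. *)
have DE (t : cotens L E (submod N')) :
    tens_in N (cmap (@submod_incl _ _ N') t) -> tens_in D t.
  move=> tN; have [u uD uE] : exists2 u, tens_in D u
      & cmap (@submod_incl _ _ N') u = cmap (@submod_incl _ _ N') t.
    elim: tN => [|a y w yN _ [u uD <-]]; first by exists 0; [constructor|exact: cmap0].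
    exists (ct a (Submod (NN' y yN)) + u); first by constructor.
    by rewrite cmapD cmapE.
  by rewrite -(inclI _ _ uE).
have Ds : stable rhoN' D.
  by move=> z zD; apply: DE; rewrite -[cmap _ _]rhoN'E; exact: Ns.
have [rhoQ rhoQE] := stable_quot_comodule Ds.
exists rhoQ; first exact: rhoQE.
pose x' := Submod xN'.
apply: (@cyclic_comodule_iso _ _ (quotmod_proj D x')).
- by apply: contra xN => /eqP/quotmod_projP.
- move=> a am; rewrite -linearZ; apply/quotmod_projP.
  exact: mx.
- rewrite /primitive rhoQE -/(cmap _ _) -cmapE.
  apply/eqP; rewrite -subr_eq0 -cmapB; apply/eqP.
  apply: (@tens_in_cmap_ker _ _ _ _ _ _ _ D) => [y /quotmod_projP //|].
  by apply: DE; rewrite cmapB cmapE -[cmap _ _]rhoN'E.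
- move=> z; have [y <-] := quotmod_surj z; have [r yr] := gen _ (submod_valP y).
  exists r; rewrite -linearZ; apply/quotmod_projB; exact: yr.
Qed.

Hypotheses (noethR : noetherian R) (flatG : flat (ralg E)).
Hypothesis unip : unipotent (quot_hopf inv).
Hypotheses (fgM : fin_gen M) (discM : discrete m M).

(** A non-zero primitive of M / N killed by m lifts to some x, and N' is N + R x. *)
Lemma trivial_step_exists (N : submodClosed M) :
  stable rho N -> (exists x, x \notin N) -> exists N', trivial_step N N'.
Proof.
move=> Ns [x0 x0N]; have [rhoQ rhoQE] := stable_quot_comodule Ns.
have [|||q [q0 qp mq]] := exists_primitive noethR flatG unip rhoQ.
- by exists (quotmod_proj N x0); apply: contra x0N => /eqP/quotmod_projP.
- exact: fin_gen_surj (@quotmod_surj _ _ N) fgM.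
- move=> q; have [x <-] := quotmod_surj q; have [k k1 kx] := discM x.
  by exists k => // a ak; rewrite -linearZ kx ?linear0.
have [x qE] := quotmod_surj q; subst q.
have [N' N'E] := @submod_of_pred _ _ (fun y => exists r, y - r *: x \in N)
  (ltac:(by exists 0; rewrite scale0r subr0 rpred0))
  (ltac:(by move=> y z [r yr] [s zs]; exists (r + s);
            rewrite scalerDl opprD addrACA rpredD))
  (ltac:(by move=> a y [r yr]; exists (a * r); rewrite -scalerA -scalerBr rpredZ)).
exists N', x; split.
- split; first by apply/N'E; exists 1; rewrite scale1r subrr rpred0.
  by apply: contra q0 => /quotmod_projP/eqP.
- by move=> y yN; apply/N'E; exists 0; rewrite scale0r subr0.
- by move=> y /N'E.
- by move=> a am; apply/quotmod_projP; rewrite linearZ; exact: mq.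
(* Primitivity of the class of x says that rho x - 1 (x) x vanishes in G (x) (M / N); right
   exactness does the rest. *)
- apply: cmap_quotmod_ker; rewrite cmapB cmapE -[cmap _ _]rhoQE qp; exact: subrr.
Qed.

Lemma trivial_filtration_exists : exists l F, trivial_filtration inv rho l F.
Proof.
have [Z ZE] := @submod_of_pred R M (fun x => x = 0) erefl
  (ltac:(by move=> _ _ -> ->; rewrite addr0)) (ltac:(by move=> a _ ->; rewrite scaler0)).
(* The conditions on N stand under the existential, so that choice gives a total function [next]; N
   is a dummy witness where they fail. *)
have /choice[next nextP] (N : submodClosed M) : exists N' : submodClosed M,
    stable rho N -> (exists x, x \notin N) -> trivial_step N N'.
  have [[Ns Nn]|h] := pselect (stable rho N /\ exists x, x \notin N).
    by have [N' ?] := trivial_step_exists Ns Nn; exists N'.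
  by exists N => *; case: h.
pose F k : submodClosed M :=
  iter k (fun N : submodClosed M =>
            if pselect (exists x, x \notin N) then next N else N) Z.
have FS k : (exists x, x \notin F k) -> F k.+1 = next (F k).
  by move=> h; rewrite /F iterS; case: pselect.
have Ff k : ~ (exists x, x \notin F k) -> F k.+1 = F k.
  by move=> h; rewrite /F iterS; case: pselect.
have Fs k : stable rho (F k).
  elim: k => [|k IH].
    by move=> x /ZE ->; rewrite linear0; constructor.
  have [h|/Ff -> //] := pselect (exists x, x \notin F k).
  by rewrite FS //; apply: (trivial_step_stable IH); apply: nextP.
have Fstep k : (exists x, x \notin F k) -> trivial_step (F k) (F k.+1).
  by move=> h; rewrite FS //; apply: nextP.
have Fle k x : x \in F k -> x \in F k.+1.
  have [/Fstep[? [_ le _ _ _]]|/Ff -> //] := pselect (exists x, x \notin F k).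
  exact: le.
(* Where the chain stops growing, F k is M: otherwise the next step would add a new element. *)
have full : exists k, `[< forall x, x \in F k >].
  have [k kP] := noetherian_chain noethR fgM Fle; exists k; apply/asboolP => x.
  apply: contraT => xk; have [y [[yS yk] _ _ _ _]] := Fstep k (ex_intro _ x xk).
  by case/negP: yk; apply: kP.
(* Minimality of l makes F k proper for every k < l, so each of these steps is a genuine one. *)
have [l /asboolP lP lmin] := ex_minnP full.
have [rhoF rhoFE] : exists rhoF : forall k, comodule H (submod (F k)),
    forall k, comodule_hom (rhoF k) rho (@submod_incl _ _ (F k)).
  have h k := cid (stable_sub_comodule flatG (Fs k)).
  by exists (fun k => projT1 (h k)) => k; exact: projT2 (h k).
exists l, F; split=> //.
- by move=> x; apply/idP/eqP => /ZE.
- by move=> k _; exact: Fle.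
exists rhoF; split=> // k kl; apply: trivial_step_iso flatG (Fs k) _ (rhoFE k.+1).
apply: Fstep; apply: contrapT => h.
suff : (l <= k)%N by rewrite leqNgt kl.
apply: lmin; apply/asboolP => x; apply: contraT => xk; case: h; by exists x.
Qed.
End Filtration.

Theorem theorem3p2 (R G : comNzRingType) (H : hopf_algebroid R G)
  (m : maximal_idealr R) (locR : local_with m) (noethR : noetherian R)
  (flatG : flat (ralg (etaR H)))
  (inv : invariant_ideal H m) (unip : unipotent (quot_hopf inv))
  (M : lmodType R) (rho : comodule H M)
  (ntM : exists x : M, x != 0) (fgM : fin_gen M) (discM : discrete m M) :
  exists (l : nat) (F : nat -> submodClosed M), trivial_filtration inv rho l F.
Proof. exact: trivial_filtration_exists. Qed.
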